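(* Let $\Omega=(a,b)\subset\mathbb{R}$ be a finite interval, $0<\alpha<1$ and $1<p<\infty$. Then there exists a constant $C=C(\alpha,\Omega)>0$ such that, for each choice of sign $\pm$, $$\|u\|_{L^p(\Omega)}\le C\,\|{}^{\pm}\mathcal{D}^{\alpha}u\|_{L^p(\Omega)}\qquad\forall\,u\in W^{\alpha,p}(\Omega).$$
   Context: Fractional integrals on $(a,b)$, for $\sigma>0$: ${}^{-}I^{\sigma}f(x)=\frac{1}{\Gamma(\sigma)}\int_a^x\frac{f(y)}{(x-y)^{1-\sigma}}\,dy$ and ${}^{+}I^{\sigma}f(x)=\frac{1}{\Gamma(\sigma)}\int_x^b\frac{f(y)}{(y-x)^{1-\sigma}}\,dy$. For $0<\alpha<1$: ${}^{-}D^{\alpha}\varphi=\frac{d}{dx}\,{}^{-}I^{1-\alpha}\varphi$ and ${}^{+}D^{\alpha}\varphi=-\frac{d}{dx}\,{}^{+}I^{1-\alpha}\varphi$. Weak fractional derivatives ($0<\alpha<1$): for $u\in L^1(\Omega)$, $v\in L^1_{loc}(\Omega)$ is the left (resp. right) weak fractional derivative of $u$, written ${}^{-}\mathcal{D}^{\alpha}u=v$ (resp. ${}^{+}\mathcal{D}^{\alpha}u=v$), if $\int_\Omega v\varphi\,dx=\int_\Omega u\,{}^{+}D^{\alpha}\varphi\,dx$ (resp. with ${}^{-}D^{\alpha}\varphi$ on the right-hand side) for all $\varphi\in C_0^\infty(\Omega)$. The symmetric fractional Sobolev space is $W^{\alpha,p}(\Omega)={}^{-}W^{\alpha,p}(\Omega)\cap{}^{+}W^{\alpha,p}(\Omega)$,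 where ${}^{\pm}W^{\alpha,p}(\Omega)=\{u\in L^p(\Omega):{}^{\pm}\mathcal{D}^{\alpha}u\in L^p(\Omega)\}$. *)

(* Defs.v *)
From HB Require Import structures.
From mathcomp Require Import all_boot all_order all_algebra.
From mathcomp Require Import all_classical all_reals all_analysis.
Set Implicit Arguments.
Unset Strict Implicit.
Unset Printing Implicit Defensive.
Import Order.TTheory GRing.Theory Num.Theory.
Import numFieldNormedType.Exports.

Local Open Scope classical_set_scope.
Local Open Scope ring_scope.

Section Lebesgue_spaces.
Context {R : realType}.
Local Notation mu := (@lebesgue_measure R).

(* The elements of L^p(D) are represented by functions on R whose values
   outside D are disregarded: they are replaced by 0 through u \_ D. *)
Definition Lp (D : set R) (p : \bar R) : set (R -> R) :=
  [set u | u \_ D \in Lfun mu p].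

Definition Lp_norm (D : set R) (p : \bar R) (u : R -> R) : \bar R :=
  Lnorm mu p (EFin \o (u \_ D)).

End Lebesgue_spaces.

Section test_functions.
Context {R : realType}.

Definition smooth (f : R -> R) : Prop :=
  forall (n : nat) (x : R), derivable (derive1n n f) x 1.

(* C_0^oo(D); for D open, extension by 0 identifies the test functions on D
   with these functions on R. *)
Definition Cc_infty (D : set R) : set (R -> R) :=
  [set f | [/\ smooth f,
               compact (closure [set x | f x != 0]) &
               closure [set x | f x != 0] `<=` D]].

End test_functions.

Section fractional_calculus.
Context {R : realType}.
Local Notation mu := (@lebesgue_measure R).
Implicit Types (a b s alpha x : R) (p : \bar R) (f u v : R -> R).

(* Euler's integral; meaningful for 0 < s *)
Definition Gamma s : R :=
  \int[mu]_(t in `]0, +oo[) (t `^ (s - 1) * expR (- t)).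

Definition frac_int_left a s f x : R :=
  (Gamma s)^-1 * \int[mu]_(y in `]a, x[) (f y / (x - y) `^ (1 - s)).

Definition frac_int_right b s f x : R :=
  (Gamma s)^-1 * \int[mu]_(y in `]x, b[) (f y / (y - x) `^ (1 - s)).

Definition frac_der_left a alpha f : R -> R :=
  derive1 (frac_int_left a (1 - alpha) f).

Definition frac_der_right b alpha f : R -> R :=
  fun x => - derive1 (frac_int_right b (1 - alpha) f) x.

(* v is a left (resp. right) weak derivative of u of order alpha on ]a, b[;
   note that the left one is tested against right derivatives and conversely. *)
Definition weak_frac_der_left a b alpha u v : Prop :=
  [/\ Lp `]a, b[ 1%E u, locally_integrable `]a, b[ v &
      forall phi, Cc_infty `]a, b[ phi ->
        \int[mu]_(x in `]a, b[) (v x * phi x) =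
        \int[mu]_(x in `]a, b[) (u x * frac_der_right b alpha phi x)].

Definition weak_frac_der_right a b alpha u v : Prop :=
  [/\ Lp `]a, b[ 1%E u, locally_integrable `]a, b[ v &
      forall phi, Cc_infty `]a, b[ phi ->
        \int[mu]_(x in `]a, b[) (v x * phi x) =
        \int[mu]_(x in `]a, b[) (u x * frac_der_left a alpha phi x)].

Definition Sobolev_left a b alpha p : set (R -> R) :=
  [set u | Lp `]a, b[ p u /\
           exists v, Lp `]a, b[ p v /\ weak_frac_der_left a b alpha u v].

Definition Sobolev_right a b alpha p : set (R -> R) :=
  [set u | Lp `]a, b[ p u /\
           exists v, Lp `]a, b[ p v /\ weak_frac_der_right a b alpha u v].

Definition Sobolev a b alpha p : set (R -> R) :=
  Sobolev_left a b alpha p `&` Sobolev_right a b alpha p.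

End fractional_calculus.

(* Main.v *)
(* Extend u and v by 0 and let J^s denote the left fractional integral. If v is
   the left weak derivative of u, testing against phi and Fubini turn the
   definition into a du Bois-Reymond condition for J^(1-alpha) u - J^1 v, which
   is therefore a constant c almost everywhere on ]a, b[. Applying J^alpha gives
     J^1 u (x) = K c (x - a)^alpha + J^(alpha+1) v (x)
   with K > 0. The boundary term is killed by the other derivative: reflecting
   x to -x, the same identity for the right derivative w of u shows that
   J^1 u (a + h) = o(h^alpha) as h tends to 0, whence c = 0. Differentiating,
   u = J^alpha v almost everywhere, and Young's inequality bounds the norm of
   J^alpha on L^p(a, b) by a multiple of (b - a)^alpha, uniformly in p. *)
Require Import Defs.
From mathcomp Require Import all_boot all_order all_algebra.
From mathcomp Require Import all_classical all_reals all_analysis.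
From mathcomp Require Import measurable_realfun ring lra.
Import Order.TTheory GRing.Theory Num.Theory.
Import numFieldNormedType.Exports.
Set Implicit Arguments.
Unset Strict Implicit.
Unset Printing Implicit Defensive.
Local Open Scope classical_set_scope.
Local Open Scope ring_scope.

(** * Affine changes of variable for Lebesgue integrals *)

Section substitution.
Context {R : realType}.
Notation mu := (@lebesgue_measure R).
Local Open Scope ereal_scope.

(** The symmetric space is essential: (x - a)^(alpha - 1) has left derivative 0 and lies in L^p when
    p (1 - alpha) < 1, so for these p no one-sided estimate can hold. The constant c detects this
    function. To exclude it, the identity for J^(1-alpha) u is lifted to J^1 u, where it holds at
    every point and can be evaluated at a + h. Seen from the right, the primitive of u near a
    involves the power t_+^alpha only through increments over [t - h, t]. These are at most h^alpha
    and, for fixed t, o(h^alpha); dominated convergence then gives the o(h^alpha) for any integrable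
    w, and the unknown constant of the right representation does no harm.

    The exponent p enters only in the final estimate, the representation of u being an L^1
    statement. One bound A for both the row and the column integrals of the kernel produces the
    factors A^(p - 1) and A, hence operator norm at most A for all p.

    Integrals run over the whole line, with functions extended by 0 and truncated kernels. A
    divergent real integral has the value 0, so passages between real and extended integrals have to
    be secured by finiteness. *)

Lemma ge0_integral_affine (c d : R) (f : R -> \bar R) : (0 < c)%R ->
  measurable_fun [set: R] f -> (forall x, 0 <= f x) ->
  \int[mu]_x f (c * x + d)%R = (c^-1)%:E * \int[mu]_x f x.
Proof.
move=> c0 mf f0.
pose phi : measurableTypeR R -> measurableTypeR R := fun x => (c * x + d)%R.
have mphi : measurable_fun [set: R] phi.
  by apply: measurable_funD => //; exact: measurable_funM.
have cN0 : (0 <= c)%R := ltW c0.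
pose k : {nonneg R} := NngNum cN0.
(* Lebesgue measure is characterised by its values on intervals []p, q]], and [c] times the
   pushforward under [phi] has these values. *)
have e A : measurable A -> mu A = mscale k (pushforward mu phi) A.
  apply: lebesgue_measure_unique => _ [[p q]] _ <-.
  rewrite /mscale /= /pushforward.
  rewrite [X in _ = c%:E * mu X](_ : _ = `](p - d) / c, (q - d) / c]%classic)%R.
    rewrite !lebesgue_measure_itv/= !lte_fin ltr_pM2r ?invr_gt0// ltrBrDr subrK.
    case: ifPn => _; last by rewrite mule0.
    rewrite -!EFinD -EFinM; congr EFin; field; exact: lt0r_neq0.
  apply/seteqP; split => x /=; rewrite !in_itv/= /phi => /andP[];
    by rewrite ?ltr_pdivrMr ?ler_pdivlMr// ?ltrBlDr ?lerBrDr (mulrC x) => -> ->.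
rewrite [in RHS](eq_measure_integral (mscale k (pushforward mu phi)))/=; last first.
  by move=> A mA _; exact: e.
rewrite ge0_integral_mscale//= muleA -EFinM mulVf ?gt_eqF// mul1e.
by rewrite ge0_integral_pushforward.
Qed.

(** Positive and negative parts are transported separately, so the equality also covers functions
    whose integral is infinite or takes a default value. *)
Lemma integral_measure_preserving (phi : R -> R) (f : R -> \bar R) :
  measurable_fun [set: R] phi ->
  (forall A, measurable A -> mu (phi @^-1` A) = mu A) ->
  measurable_fun [set: R] f ->
  \int[mu]_x f (phi x) = \int[mu]_x f x.
Proof.
move=> mphi phiE mf.
have ge0 (g : R -> \bar R) : measurable_fun [set: R] g -> (forall x, 0 <= g x) ->
    \int[mu]_x g (phi x) = \int[mu]_x g x.
  move=> mg g0.
  rewrite [in RHS](eq_measure_integral (pushforward mu (phi : measurableTypeR R -> measurableTypeR R)))/=; last first.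
    by move=> A mA _; rewrite /pushforward -phiE.
  by rewrite ge0_integral_pushforward.
rewrite integralE [RHS]integralE.
congr (_ - _).
- under eq_integral do rewrite funepos_comp/=.
  by apply: (ge0 f^\+) => //; exact: measurable_funepos.
- under eq_integral do rewrite funeneg_comp/=.
  by apply: (ge0 f^\-) => //; exact: measurable_funeneg.
Qed.

Lemma integralN_arg (f : R -> \bar R) : measurable_fun [set: R] f ->
  \int[mu]_x f (- x)%R = \int[mu]_x f x.
Proof.
apply: integral_measure_preserving => // A mA.
exact: lebesgue_measureN.
Qed.

Lemma integral_shift (d : R) (f : R -> \bar R) : measurable_fun [set: R] f ->
  \int[mu]_x f (x + d)%R = \int[mu]_x f x.
Proof.
apply: integral_measure_preserving; first exact: measurable_funD.
move=> A mA; rewrite -[X in _ = mu X]setIT -integral_indic//.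
have := @ge0_integral_affine 1 d (fun x => (\1_A x)%:E) ltr01.
rewrite invr1 mul1e => <-//; last first.
  by apply/measurable_EFinP.
rewrite -[in LHS](setIT (_ @^-1` _)) -integral_indic//; last first.
  by rewrite -[X in measurable X]setTI; apply: measurable_funD.
by apply: eq_integral => x _; rewrite mul1r.
Qed.

Lemma integral_reflect (c : R) (f : R -> \bar R) : measurable_fun [set: R] f ->
  \int[mu]_x f (c - x)%R = \int[mu]_x f x.
Proof.
move=> mf; rewrite -[RHS](integral_shift c)//.
rewrite -[RHS](@integralN_arg (fun x => f (x + c)%R)).
  by apply: eq_integral => x _; rewrite addrC.
by apply: measurableT_comp => //; exact: measurable_funD.
Qed.

End substitution.

(** * Bounded multipliers and the fundamental theorem of calculus *)

Lemma integrable_bounded_mul (R : realType) (g h : R -> R) (N : R) :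
  let mu := @lebesgue_measure R in
  measurable_fun [set: R] g -> (forall x, `|g x| <= N) ->
  mu.-integrable [set: R] (EFin \o h) ->
  mu.-integrable [set: R] (fun x => (g x * h x)%:E).
Proof.
move=> mu mg gN ih.
have iN := integrableZl measurableT `|N| ih.
apply: le_integrable iN => //.
  apply/measurable_EFinP; apply: measurable_funM => //.
  by apply/measurable_EFinP; exact: measurable_int ih.
move=> z _; rewrite /comp EFinM !abseM; apply: lee_wpmul2r => //.
by rewrite /= lee_fin normr_id (le_trans (gN z))// ler_norm.
Qed.

Lemma integral_derivative {R : realType} (x y : R) (F f : R -> R) : x <= y ->
  (forall z, x <= z <= y -> derivable F z 1 /\ derive1 F z = f z) ->
  {within `[x, y], continuous f} ->
  (\int[lebesgue_measure]_(z in `[x, y]) (f z)%:E = (F y - F x)%:E)%E.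
Proof.
rewrite le_eqVlt => /predU1P[<- _ _|xy dF cf].
  by rewrite set_itv1 integral_set1 subrr.
have dF' z : x < z < y -> derivable F z 1 /\ derive1 F z = f z.
  by move=> /andP[xz zy]; apply: dF; rewrite !ltW.
have cF z : x <= z <= y -> {for z, continuous F}.
  by move=> /dF[dFz _]; apply/differentiable_continuous/derivable1_diffP.
rewrite (@continuous_FTC2 _ f F _ _ xy cf)//.
- split.
  + by move=> z; rewrite in_itv/= => /dF'[].
  + by apply: cvg_at_right_filter; apply: cF; rewrite lexx ltW.
  + by apply: cvg_at_left_filter; apply: cF; rewrite lexx ltW.
- by move=> z; rewrite in_itv/= => /dF'[].
Qed.

(** * The power kernel on the half-line and the beta integral *)

Section power_kernel.
Context {R : realType}.
Notation mu := (@lebesgue_measure R).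
Implicit Types s r t x y z c : R.

(* In particular pker 1 is the indicator of ]0, +oo[: factors pker 1 (b - x) and
   pker 1 (x - a) below truncate to x < b and a < x. *)
Definition pker s : R -> R := (fun t => t `^ (s - 1)) \_ `]0, +oo[.

Lemma pker_gt0 s t : 0 < t -> pker s t = t `^ (s - 1).
Proof. by move=> t0; rewrite /pker patchE mem_set//= in_itv/= t0. Qed.

Lemma pker_le0 s t : t <= 0 -> pker s t = 0.
Proof.
move=> t0; rewrite /pker patchE memNset//= in_itv/= andbT.
by apply/negP; rewrite -leNgt.
Qed.

Lemma pker_ge0 s t : 0 <= pker s t.
Proof.
by have [/pker_le0 ->//|/pker_gt0 ->] := leP t 0; rewrite powR_ge0.
Qed.

Lemma measurable_pker s : measurable_fun [set: R] (pker s).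
Proof.
apply/(measurable_restrictT _ _).1 => //.
by apply: measurable_funTS; exact: measurable_powR.
Qed.

Lemma pker1 t : pker 1 t = (0 < t)%R%:R.
Proof.
have [/pker_le0 ->//|/pker_gt0 ->] := leP t 0.
by rewrite subrr powRr0.
Qed.

Lemma pkerM s c t : 0 < c -> pker s (c * t) = c `^ (s - 1) * pker s t.
Proof.
move=> c0; have [t0|t0] := leP t 0.
  by rewrite !pker_le0 ?mulr0// pmulr_rle0.
by rewrite !pker_gt0 ?mulr_gt0// powRM// ltW.
Qed.

Lemma pker_le s t : 0 < s -> 0 < t -> t <= 1 -> pker s t <= t^-1.
Proof.
move=> s0 t0 t1; rewrite pker_gt0// -(powR_inv1 (ltW t0)).
by apply: ger_powR; rewrite ?t0//; lra.
Qed.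

Lemma pker_ge1 s t : s <= 1 -> 0 < t -> t <= 1 -> 1 <= pker s t.
Proof.
move=> s1 t0 t1; rewrite pker_gt0// -[leLHS](@powRr0 _ t).
by apply: ger_powR; rewrite ?t0//; lra.
Qed.

(** The singularity at 0 is approached through the segments [1/(n + 1), 1]; on each of them the
    primitive t^s / s gives at most 1/s. *)
Lemma integral_powR_lty s : 0 < s ->
  (\int[mu]_(t in `]0%R, 1%R]) (t `^ (s - 1))%:E < +oo)%E.
Proof.
move=> s0.
pose F n : set R := `[n.+1%:R^-1, 1]%classic.
have E : `]0, 1]%classic = \bigcup_n F n :> set R.
  apply/seteqP; split => t /=; rewrite ?in_itv/=.
  - move=> /andP[t0 t1]; exists (Num.truncn t^-1) => //=.
    rewrite /F/= in_itv/= t1 andbT -[leRHS]invrK lef_pV2 ?posrE ?invr_gt0 ?ltr0n//.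
    by rewrite ltW// truncnS_gt.
  - move=> [n _]; rewrite /F/= in_itv/= => /andP[nt ->]; rewrite andbT.
    by apply: lt_le_trans nt; rewrite invr_gt0.
rewrite E; apply: (@le_lt_trans _ _ (s^-1)%:E); last exact: ltry.
have nF : nondecreasing_seq F.
  move=> m n mn; apply/subsetPset => t; rewrite /F/= !in_itv/= => /andP[mt ->].
  rewrite andbT (le_trans _ mt)// lef_pV2 ?posrE// ler_nat ltnS//.
have mf D : measurable D -> measurable_fun D (fun t : R => (t `^ (s - 1))%:E).
  by move=> mD; apply/measurable_EFinP/measurable_funTS.
have cvg : (\int[mu]_(t in F n) (t `^ (s - 1))%:E)%E @[n --> \oo] -->
    (\int[mu]_(t in \bigcup_n F n) (t `^ (s - 1))%:E)%E.
  apply: ge0_nondecreasing_set_cvg_integral => //.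
  - by move=> i; exact: measurable_itv.
  - by move=> i; apply: mf; exact: measurable_itv.
  - by move=> i x _; rewrite lee_fin powR_ge0.
rewrite -(cvg_lim _ cvg)//; apply: lime_le; first by apply/cvg_ex; eexists; exact: cvg.
near=> n.
rewrite (@integral_derivative _ _ _ (fun t => s^-1 * t `^ s))//.
- rewrite powR1 mulr1 lee_fin lerBlDr lerDl mulr_ge0 ?powR_ge0//.
  by rewrite invr_ge0 ltW.
- by rewrite invf_le1// ler1n.
- move=> z /andP[nz _]; have z0 : 0 < z by apply: lt_le_trans nz; rewrite invr_gt0.
  suff [? ?] : is_derive z 1 (fun t => s^-1 * t `^ s) (z `^ (s - 1)).
    by rewrite derive1E.
  have dz := is_derive1_powR s z0.
  rewrite (_ : z `^ (s - 1) = s^-1 *: (s * z `^ (s - 1) : R^o)).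
    exact: is_deriveZ.
  by rewrite /GRing.scale/= mulrA mulVf ?mul1r// gt_eqF.
- apply: derivable_within_continuous => z; rewrite in_itv/= => /andP[nz _].
  apply: derivable_powR; rewrite in_itv/= andbT.
  by apply: lt_le_trans nz; rewrite invr_gt0.
Unshelve. all: by end_near. Qed.

(* For 0 < s, r the factor pker s (1 - y) * pker r y vanishes outside ]0, 1[, so
   this is Euler's beta integral. *)
Definition pbeta s r : \bar R :=
  \int[mu]_y (pker s (1 - y) * pker r y)%:E.

Lemma measurable_pkerB s (f : R -> R) : measurable_fun [set: R] f ->
  measurable_fun [set: R] (fun y => pker s (f y)).
Proof. by move=> mf; exact: measurableT_comp (measurable_pker s) mf. Qed.

(** The substitution y = (x - z) t + z and the homogeneity of both kernels leave the beta integral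
    in t, times x - z to the power (s - 1) + (r - 1) + 1. For x <= z the supports of the two factors
    do not meet. *)
Lemma pker_conv s r x z :
  (\int[mu]_y (pker s (x - y) * pker r (y - z))%:E =
   pbeta s r * (pker (s + r) (x - z))%:E)%E.
Proof.
have [xz|zx] := leP x z.
  rewrite [in RHS]pker_le0 ?subr_le0// mule0 integral0_eq// => y _.
  have [xy|yx] := leP x y; first by rewrite pker_le0 ?subr_le0// mul0r.
  rewrite [X in _ * X]pker_le0 ?mulr0// subr_le0.
  exact: le_trans (ltW yx) xz.
pose c := x - z; have c0 : 0 < c by rewrite subr_gt0.
have := @ge0_integral_affine _ c z (fun y => (pker s (x - y) * pker r (y - z))%:E) c0.
move=> /(_ _ _)/wrap[].
- apply/measurable_EFinP; apply: measurable_funM; apply: measurable_pkerB.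
    exact: measurable_funB.
  exact: measurable_funB.
- by move=> y; rewrite lee_fin mulr_ge0 ?pker_ge0.
move=> h.
rewrite -[LHS]mul1e -(@divff _ c) ?gt_eqF// EFinM -muleA -{}h.
under eq_integral => t _.
  rewrite (_ : x - (c * t + z) = c * (1 - t)); last by rewrite /c; ring.
  rewrite addrK !pkerM// mulrACA EFinM.
  over.
rewrite ge0_integralZl//.
- rewrite -/(pbeta s r) muleA muleC; congr (_ * _)%E.
  rewrite -EFinM pker_gt0//; congr EFin; have cn0 := lt0r_neq0 c0.
  rewrite -[X in X * _](@powRr1 _ c) ?ltW// -!powRD ?cn0 ?implybT//.
  by congr (_ `^ _); ring.
- apply/measurable_EFinP; apply: measurable_funM; apply: measurable_pkerB => //.
  exact: measurable_funB.
- by move=> y _; rewrite lee_fin mulr_ge0 ?pker_ge0.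
- by rewrite lee_fin mulr_ge0 ?powR_ge0.
Qed.

Lemma integral_pker_lty s : 0 < s ->
  (\int[mu]_(t in `]0%R, 1%R]) (pker s t)%:E < +oo)%E.
Proof.
move=> s0; under eq_integral => t.
  rewrite inE/= in_itv/= => /andP[t0 _]; rewrite pker_gt0//; over.
exact: integral_powR_lty.
Qed.

(** On either side of 1/2 one of the two factors is at most 2, by [pker_le]. The product is thus at
    most twice the sum of the factors, each of which is integrable on []0, 1]]. *)
Lemma pbeta_lty s r : 0 < s -> 0 < r -> (pbeta s r < +oo)%E.
Proof.
move=> s0 r0.
pose g s : R -> \bar R := (fun t => (pker s t)%:E) \_ `]0, 1].
have mg q : measurable_fun [set: R] (g q).
  apply/(measurable_restrictT _ _).1 => //; apply: measurable_funTS.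
  by apply/measurable_EFinP; exact: measurable_pker.
have g0 q t : (0 <= g q t)%E.
  by apply: erestrict_ge0 => {}t _; rewrite lee_fin pker_ge0.
have gE q t : 0 < t -> t <= 1 -> g q t = (pker q t)%:E.
  by move=> t0 t1; rewrite /g patchE mem_set//= in_itv/= t0.
have mg' : measurable_fun [set: R] (fun y => g s (1 - y)).
  by apply: measurableT_comp => //; exact: measurable_funB.
have ilt q : 0 < q -> (\int[mu]_t g q t < +oo)%E.
  by move=> q0; rewrite -integral_mkcond; exact: integral_pker_lty.
have pt t : ((pker s (1 - t) * pker r t)%:E <=
    2%:E * (g s (1 - t)%R + g r t))%E.
  have rhs0 : (0 <= 2%:E * (g s (1 - t)%R + g r t))%E.
    by rewrite mule_ge0 ?adde_ge0// lee_fin.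
  have [t0|t0] := leP t 0; first by rewrite [X in _ * X]pker_le0 ?mulr0.
  have [t1|t1] := leP 1 t; first by rewrite pker_le0 ?mul0r// subr_le0.
  have u0 : 0 < 1 - t by clear rhs0; lra.
  have u1 : 1 - t <= 1 by clear rhs0; lra.
  rewrite !gE//; last exact: ltW.
  clear rhs0 ilt mg' gE g0 mg g.
  rewrite -EFinD -EFinM lee_fin.
  have p1 := pker_ge0 s (1 - t); have p2 := pker_ge0 r t.
  have [th|th] := leP (2^-1) t.
    have : pker r t <= 2.
      apply: (le_trans (pker_le _ _ _)) => //; first exact: ltW.
      by rewrite -[leRHS]invrK lef_pV2 ?posrE.
    nra.
  have : pker s (1 - t) <= 2.
    apply: (le_trans (pker_le _ _ _)) => //; try lra.
    rewrite -[leRHS]invrK lef_pV2 ?posrE//; lra.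
  nra.
apply: (@le_lt_trans _ _ (\int[mu]_t (2%:E * (g s (1 - t)%R + g r t)))%E).
  apply: ge0_le_integral => //.
  - by move=> y _; rewrite lee_fin mulr_ge0 ?pker_ge0.
  - apply/measurable_EFinP; apply: measurable_funM; apply: measurable_pkerB => //.
    exact: measurable_funB.
  - by apply: measurable_funeM; exact: emeasurable_funD mg' (mg r).
rewrite ge0_integralZl//; last 2 first.
- exact: emeasurable_funD mg' (mg r).
- by move=> t _; rewrite adde_ge0.
rewrite ge0_integralD//.
by rewrite integral_reflect// lte_mul_pinfty// lte_add_pinfty// ?ilt.
exact: mg.
Qed.

Lemma pbeta_ge0 s r : (0 <= pbeta s r)%E.
Proof. by apply: integral_ge0 => y _; rewrite lee_fin mulr_ge0 ?pker_ge0. Qed.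

Lemma pbeta_fin_num s r : 0 < s -> 0 < r -> pbeta s r \is a fin_num.
Proof. by move=> s0 r0; rewrite ge0_fin_numE ?pbeta_ge0 ?pbeta_lty. Qed.

(** Both exponents being nonpositive, each factor is at least 1 on []0, 1[]. *)
Lemma pbeta_gt0 s r : s <= 1 -> r <= 1 -> (0 < pbeta s r)%E.
Proof.
move=> s1 r1.
apply: (@lt_le_trans _ _ (\int[mu]_t (\1_(`]0, 1[%classic) t)%:E)%E).
  rewrite integral_indic// setIT.
  rewrite -[X in (_ < X)%E]/(mu `]0, 1[%classic) lebesgue_measure_itv/= lte_fin ltr01.
  by rewrite oppr0 adde0 lte_fin.
apply: ge0_le_integral => //.
- exact/measurable_EFinP.
- apply/measurable_EFinP; apply: measurable_funM; apply: measurable_pkerB => //.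
  exact: measurable_funB.
move=> t _; rewrite lee_fin indicE; case: (boolP (t \in _)) => [|_].
  rewrite inE/= in_itv/= => /andP[t0 t1].
  by rewrite -[leLHS]mulr1 ler_pM// pker_ge1//; lra.
by rewrite mulr_ge0 ?pker_ge0.
Qed.

End power_kernel.

(** * Finiteness and positivity of Euler's integral *)

Section gamma.
Context {R : realType}.
Notation mu := (@lebesgue_measure R).

(** Finiteness is part of the claim, since [fine] would send an infinite integral to 0. The
    integrand is dominated by the kernel on []0, 1]] and by the exponential density beyond 1, and it
    is at least 1/e on []0, 1[]. *)
Lemma Gamma_gt0 (s : R) : 0 < s -> s <= 1 -> 0 < Gamma s.
Proof.
move=> s0 s1.
pose h t : R := pker s t * expR (- t).
have h0 t : 0 <= h t by rewrite mulr_ge0 ?pker_ge0 ?expR_ge0.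
have mh : measurable_fun [set: R] h.
  apply: measurable_funM; first exact: measurable_pker.
  exact: measurableT_comp.
have E : (\int[mu]_(t in `]0%R, +oo[) (t `^ (s - 1) * expR (- t))%:E =
    \int[mu]_t (h t)%:E)%E.
  rewrite integral_mkcond; apply: eq_integral => t _.
  rewrite patchE /h; have [t0|t0] := leP t 0.
    by rewrite memNset ?pker_le0 ?mul0r//= in_itv/= andbT ltNge t0.
  by rewrite mem_set/= ?pker_gt0// in_itv/= t0.
rewrite /Gamma /Rintegral E fine_gt0//; apply/andP; split.
  apply: (@lt_le_trans _ _ (\int[mu]_t (expR (-1) * \1_(`]0, 1[%classic) t)%:E)%E).
    under eq_integral do rewrite EFinM.
    rewrite ge0_integralZl//; last first.
      by apply/measurable_EFinP; exact: measurable_indic.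
    rewrite integral_indic// setIT.
    rewrite -[X in (_ * X)%E]/(mu `]0, 1[%classic) lebesgue_measure_itv/= lte_fin ltr01.
    by rewrite oppr0 adde0 mule1 lte_fin expR_gt0.
  have pt (t : R) : expR (-1) * \1_(`]0, 1[%classic) t <= h t.
    rewrite indicE; case: (boolP (t \in _)) => [|_]; last by rewrite mulr0.
    rewrite inE/= in_itv/= => /andP[t0 t1]; rewrite mulr1 -[leLHS]mul1r.
    rewrite ler_pM ?expR_ge0//; first by rewrite pker_ge1// ltW.
    by rewrite ler_expR lerN2 ltW.
  apply: ge0_le_integral => //.
  - by apply/measurable_EFinP; exact: measurable_funM.
  - exact/measurable_EFinP.
  - by move=> t _; rewrite lee_fin pt.
pose g : R -> \bar R := (fun t => (pker s t)%:E) \_ `]0, 1].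
have g0 t : (0 <= g t)%E.
  by apply: erestrict_ge0 => {}t _; rewrite lee_fin pker_ge0.
have mg : measurable_fun [set: R] g.
  apply/(measurable_restrictT _ _).1 => //; apply: measurable_funTS.
  by apply/measurable_EFinP; exact: measurable_pker.
have me : measurable_fun [set: R] (EFin \o exponential_pdf 1).
  by apply/measurable_EFinP; exact: measurable_exponential_pdf.
have pt' (t : R) : ((h t)%:E <= g t + (exponential_pdf 1 t)%:E)%E.
  have p0 : 0 <= exponential_pdf 1 t by rewrite exponential_pdf_ge0.
  have [t0|t0] := leP t 0.
    by rewrite /h pker_le0// mul0r adde_ge0// lee_fin.
  have [t1|t1] := leP t 1.
    rewrite /g patchE mem_set ?/= ?in_itv/= ?t0// -EFinD lee_fin.
    rewrite /h -[leLHS]addr0 lerD// ler_piMr ?pker_ge0//.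
    by rewrite -expR0 ler_expR oppr_le0 ltW.
  rewrite -[leLHS]add0e leeD// lee_fin (exponential_pdfE _ (ltW t0))/=.
  rewrite mul1r mulN1r /h ler_piMl ?expR_ge0//.
  rewrite pker_gt0// -[leRHS](@powRr0 _ t) ler_powR ?(ltW t1)//; lra.
apply: (@le_lt_trans _ _ (\int[mu]_t (g t + (exponential_pdf 1 t)%:E))%E).
  apply: ge0_le_integral => //.
  - by move=> y _; rewrite lee_fin.
  - exact/measurable_EFinP.
  - exact: emeasurable_funD mg me.
rewrite ge0_integralD//; last first.
  by move=> y _; rewrite lee_fin exponential_pdf_ge0.
rewrite integral_exponential_pdf// lte_add_pinfty ?ltry//.
by rewrite -integral_mkcond integral_pker_lty.
Qed.

End gamma.

(** * Integral operators whose kernel has uniformly bounded column integrals *)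

Section fubini_kernel.
Context {R : realType}.
Notation mu := (@lebesgue_measure R).
Variables (K : R -> R -> R) (f : R -> R) (M : R).
Hypothesis mK : measurable_fun [set: R * R] (fun z => K z.1 z.2).
Hypothesis M0 : 0 <= M.
Hypothesis if_ : mu.-integrable [set: R] (EFin \o f).
Hypothesis KM : forall y, f y != 0 -> (\int[mu]_x `|K x y|%:E <= M%:E)%E.

Let mf : measurable_fun [set: R] f.
Proof. by apply/measurable_EFinP; exact: measurable_int if_. Qed.

Lemma measurable_kernel1 y : measurable_fun [set: R] (K ^~ y).
Proof. exact: (measurableT_comp mK (measurable_pair2 y)). Qed.

(** By Tonelli, integrating in [x] first costs at most [M * |f y|]. The column bound is asked only
    where [f y != 0]: the kernels to come have column integrals that grow like powers of a distance
    to [y], bounded only while [y] stays in the support of [f]. *)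
Lemma integrable_kernel_prod :
  (mu \x mu)%E.-integrable [set: R * R] (fun z => (K z.1 z.2 * f z.2)%:E).
Proof.
have mh : measurable_fun [set: R * R] (fun z => (K z.1 z.2 * f z.2)%:E).
  apply/measurable_EFinP; apply: measurable_funM => //.
  exact: measurableT_comp.
apply/integrable21ltyP => //=.
apply: (@le_lt_trans _ _ (\int[mu]_y (M%:E * `|(f y)%:E|))%E); last first.
  rewrite ge0_integralZl_EFin//; last first.
    by apply: measurableT_comp => //; exact/measurable_EFinP.
  by rewrite lte_mul_pinfty//; case/integrableP: if_.
apply: ge0_le_integral => //.
- by move=> y _; exact: integral_ge0.
- apply: (measurable_fun_fubini_tonelli_G (m1 := mu) (fun z => `|(K z.1 z.2 * f z.2)%:E|%E)) => //.
  exact: measurableT_comp.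
- apply: measurable_funeM; apply: measurableT_comp => //.
  exact/measurable_EFinP.
move=> y _; under eq_integral do rewrite normrM EFinM.
rewrite ge0_integralZr//; last first.
  by do 2 apply: measurableT_comp => //; exact: measurable_kernel1.
have [->|fy0] := eqVneq (f y) 0; first by rewrite /= normr0 !mule0.
by rewrite lee_wpmul2r// KM.
Qed.

Lemma integrable_kernel1 y : f y != 0 ->
  mu.-integrable [set: R] (EFin \o (K ^~ y)).
Proof.
move=> fy; apply/integrableP; split.
  by apply/measurable_EFinP; exact: measurable_kernel1.
by apply: le_lt_trans (KM fy) _; rewrite ltry.
Qed.

Let Tf x := \int[mu]_y (K x y * f y).

Let Tf_ae : {ae mu, forall x, mu.-integrable [set: R] (fun y => (K x y * f y)%:E)}.
Proof. exact: (ae_integrable1 integrable_kernel_prod). Qed.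

Lemma measurable_kernel_op : measurable_fun [set: R] Tf.
Proof.
apply: measurableT_comp => //.
exact: (measurable_fubini_F integrable_kernel_prod).
Qed.

Lemma integrable_kernel_op : mu.-integrable [set: R] (EFin \o Tf).
Proof.
have h := integrable_fubini_F integrable_kernel_prod.
apply: le_integrable h => //.
  by apply/measurable_EFinP; exact: measurable_kernel_op.
move=> x _ /=; rewrite /Tf /Rintegral /fubini_F.
by case: (integral _ _ _) => //= *; rewrite ?normr0 ?leey.
Qed.

Lemma fubini_kernel (g : R -> R) (N : R) : measurable_fun [set: R] g ->
  (forall x, `|g x| <= N) ->
  \int[mu]_x (g x * \int[mu]_y (K x y * f y)) =
  \int[mu]_y ((\int[mu]_x (g x * K x y)) * f y).
Proof.
move=> mg gN; rewrite /Rintegral; congr fine.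
have ih : (mu \x mu)%E.-integrable [set: R * R]
    (fun z => (g z.1 * (K z.1 z.2 * f z.2))%:E).
  have N0 : 0 <= N by apply: le_trans (gN 0).
  have iN := integrableZl measurableT N integrable_kernel_prod.
  apply: le_integrable iN => //.
    apply/measurable_EFinP; apply: measurable_funM; first exact: measurableT_comp.
    by apply/measurable_EFinP; exact: measurable_int integrable_kernel_prod.
  move=> z _; rewrite EFinM !abseM; apply: lee_wpmul2r => //.
  by rewrite /= lee_fin (ger0_norm N0).
(* The inner real integral agrees with the extended one only at those [x] whose section is
   integrable, that is almost everywhere. *)
transitivity (\int[mu]_x \int[mu]_y (g x * (K x y * f y))%:E)%E.
  apply: ae_eq_integral => //.
  - by apply/measurable_EFinP; apply: measurable_funM => //; exact: measurable_kernel_op.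
  - exact: (measurable_fubini_F ih).
  apply: (@filterS _ _ (ae_filter_ringOfSetsType mu) _ _ _ Tf_ae) => x ix _.
  under [RHS]eq_integral do rewrite EFinM.
  by rewrite [RHS]integralZl// EFinM /Tf /Rintegral fineK// integrable_fin_num.
rewrite (Fubini ih); apply: eq_integral => y _ /=.
have [->|fy] := eqVneq (f y) 0.
  by rewrite mulr0 integral0_eq// => x _; rewrite !mulr0.
under eq_integral do rewrite mulrA EFinM.
have ik := integrable_kernel1 fy.
have igk : mu.-integrable [set: R] (fun x => (g x * K x y)%:E).
  exact: integrable_bounded_mul mg gN ik.
by rewrite integralZr// EFinM fineK// integrable_fin_num.
Qed.

End fubini_kernel.

(** * Closure properties of smooth functions *)

Section smooth_functions.
Context {R : realType}.
Implicit Types (f g : R -> R) (n k : nat).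

(** Derivatives are peeled off from the inside, while [smooth] iterates from the outside; in this
    form sums, products and affine substitutions go through by one induction over all functions. In
    spite of the name, no continuity is asked of the last derivative. *)
Fixpoint Cn n f : Prop :=
  if n is m.+1 then (forall x, derivable f x 1) /\ Cn m (derive1 f) else True.

Lemma derive1nSr n f : derive1n n.+1 f = derive1n n (derive1 f).
Proof. by rewrite /derive1n iterSr. Qed.

Lemma Cn_smooth f : (forall n, Cn n f) -> smooth f.
Proof.
move=> fn n; move/(_ n.+1): fn; elim: n f => [|n ih] f; first by case.
by move=> [_ /ih]; rewrite derive1nSr.
Qed.

Lemma smooth_derive1 f : smooth f -> smooth (derive1 f).
Proof. by move=> sf n x; rewrite -derive1nSr; exact: sf. Qed.

Lemma smooth_derivable f : smooth f -> forall x, derivable f x 1.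
Proof. by move=> sf x; exact: (sf 0%N x). Qed.

Lemma smooth_Cn f n : smooth f -> Cn n f.
Proof.
elim: n f => [//|n ih] f sf; split; first exact: smooth_derivable.
exact/ih/smooth_derive1.
Qed.

Lemma smooth_continuous f : smooth f -> continuous f.
Proof.
move=> sf x; apply/differentiable_continuous/derivable1_diffP.
exact: smooth_derivable.
Qed.

Lemma smooth_of_derive1 f : (forall x, derivable f x 1) -> smooth (derive1 f) ->
  smooth f.
Proof.
by move=> df sf; apply: Cn_smooth => -[//|n]; split=> //; exact: smooth_Cn.
Qed.

Lemma CnW n f : Cn n.+1 f -> Cn n f.
Proof. by elim: n f => [//|n ih] f [df /ih]. Qed.

Lemma CnD n f g : Cn n f -> Cn n g -> Cn n (fun x => f x + g x).
Proof.
elim: n f g => [//|n ih] f g [df cf] [dg cg]; split.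
  by move=> x; exact: derivableD.
rewrite (_ : derive1 _ = fun x => derive1 f x + derive1 g x); first exact: ih.
by apply/funext => x; rewrite !derive1E deriveD.
Qed.

Lemma CnM n f g : Cn n f -> Cn n g -> Cn n (fun x => f x * g x).
Proof.
elim: n f g => [//|n ih] f g cf cg; have [df cf'] := cf; have [dg cg'] := cg.
split; first by move=> x; exact: derivableM.
rewrite (_ : derive1 _ = fun x => f x * derive1 g x + g x * derive1 f x).
  by apply: CnD; apply: ih => //; exact: CnW.
by apply/funext => x; rewrite !derive1E deriveM.
Qed.

Lemma Cn_cst n (c : R) : Cn n (fun=> c).
Proof.
elim: n c => [//|n ih] c; split; first by move=> x; exact: derivable_cst.
rewrite (_ : derive1 _ = fun=> 0); first exact: ih.
by apply/funext => x; rewrite derive1_cst.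
Qed.

Lemma Cn_affine n f (c d : R) : Cn n f -> Cn n (fun x => f (c * x + d)).
Proof.
elim: n f => [//|n ih] f [df cf].
have da (x : R) : is_derive x 1 (fun x : R => c * x + d) c.
  have := is_deriveD (is_deriveZ c (is_derive_id x (1 : R))) (is_derive_cst d x (1 : R)).
  by rewrite addr0 /GRing.scale/= mulr1.
have dfa (x : R) : is_derive x 1 (fun x : R => f (c * x + d)) (derive1 f (c * x + d) * c).
  apply: (@is_derive1_comp _ f (fun x => c * x + d)).
  by apply: DeriveDef; [exact: df|rewrite derive1E].
split; first by move=> x; have [] := dfa x.
rewrite (_ : derive1 _ = fun x => derive1 f (c * x + d) * c).
  by apply: CnM; [exact: ih|exact: Cn_cst].
by apply/funext => x; rewrite derive1E; have [] := dfa x.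
Qed.

Lemma smoothD f g : smooth f -> smooth g -> smooth (fun x => f x + g x).
Proof. by move=> sf sg; apply: Cn_smooth => n; apply: CnD; exact: smooth_Cn. Qed.

Lemma smoothM f g : smooth f -> smooth g -> smooth (fun x => f x * g x).
Proof. by move=> sf sg; apply: Cn_smooth => n; apply: CnM; exact: smooth_Cn. Qed.

Lemma smooth_cst (c : R) : smooth (fun=> c).
Proof. by apply: Cn_smooth => n; exact: Cn_cst. Qed.

Lemma smooth_affine f (c d : R) : smooth f -> smooth (fun x => f (c * x + d)).
Proof. by move=> sf; apply: Cn_smooth => n; apply: Cn_affine; exact: smooth_Cn. Qed.

End smooth_functions.

(** * The flat function exp(-1/t) and smooth approximations of indicators *)

Section flat_function.
Context {R : realType}.
Implicit Types (x t : R) (n k : nat).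

(* The derivative of flat k is a combination of flat k.+1 and flat k.+2, whence
   smoothness at once for all k. *)
Definition flat k t : R :=
  if 0 < t then t^-1 ^+ k * expR (- t^-1) else 0.

Lemma flat_le0 k t : t <= 0 -> flat k t = 0.
Proof. by rewrite /flat ltNge => ->. Qed.

Lemma flat_ge0 k t : 0 <= flat k t.
Proof.
rewrite /flat; case: ifPn => // t0.
by rewrite mulr_ge0 ?expR_ge0// exprn_ge0// invr_ge0 ltW.
Qed.

Lemma flat0_le1 t : flat 0 t <= 1.
Proof.
rewrite /flat; case: ifPn => // t0.
by rewrite expr0 mul1r -expR0 ler_expR oppr_le0 invr_ge0 ltW.
Qed.

(** With u = 1/t this is u^(k + 2) <= (k + 2)! exp u, one term of the exponential series. A
    quadratic bound at the origin is what gives derivative 0 there, for all [k] alike. *)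
Lemma flat_sqr k t : flat k t <= (k.+2)`!%:R * t ^+ 2.
Proof.
rewrite /flat; case: ifPn => [t0|_]; last by rewrite mulr_ge0// sqr_ge0.
set u := t^-1; have u0 : 0 < u by rewrite invr_gt0.
have tE : t = u^-1 by rewrite invrK.
rewrite expRN ler_pdivrMr ?expR_gt0// tE.
have := expR_ge1Dxn k.+1 (ltW u0).
set F : R := _%:R; have F0 : 0 < F by rewrite ltr0n fact_gt0.
move=> /(le_trans _) h; have {}h : u ^+ k.+2 <= F * expR u.
  by rewrite mulrC -ler_pdivrMr// h// lerDr.
rewrite [u^-1 ^+ 2]exprVn mulrAC ler_pdivlMr ?exprn_gt0//.
by rewrite -exprD addn2.
Qed.

Lemma is_derive_quadratic (f : R -> R) (C : R) :
  (forall x, `|f x| <= C * x ^+ 2) -> is_derive (0 : R) 1 f 0.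
Proof.
move=> fC; have f0 : f 0 = 0.
  by apply/eqP; rewrite -normr_le0 (le_trans (fC 0))// expr0n mulr0.
have C0 : 0 <= C.
  by have := le_trans (normr_ge0 _) (fC 1); rewrite expr1n mulr1.
suff h : h^-1 *: ((f \o shift 0) (h *: (1 : R)) - f 0) @[h --> 0^'] --> (0 : R).
  by apply: DeriveDef; [apply/cvg_ex; exists 0|exact/cvg_lim].
apply/cvgrPdist_le => /= e e0.
near=> h.
have hn0 : h != 0 by near: h; exact: nbhs_dnbhs_neq.
rewrite sub0r normrN f0 subr0 addr0 /GRing.scale/= mulr1 normrM normfV.
rewrite ler_pdivrMl ?normr_gt0// (le_trans (fC h))//.
rewrite -normr_id -[h ^+ 2]ger0_norm ?sqr_ge0// normrX expr2 mulrA mulrC.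
rewrite normr_id ler_wpM2l//.
have hd : `|h| <= e / (C + 1).
  by near: h; apply: dnbhs0_le; rewrite divr_gt0// ltr_wpDl.
apply: (@le_trans _ _ ((C + 1) * `|h|)).
  by rewrite ler_wpM2r// lerDl.
by rewrite mulrC -ler_pdivlMr// ltr_wpDl.
Unshelve. all: by end_near. Qed.

Lemma is_derive_flat k t :
  is_derive t 1 (flat k) (- k%:R * flat k.+1 t + flat k.+2 t).
Proof.
have [t0|t0|->] := ltgtP t 0.
- rewrite !flat_le0 ?(ltW t0)// mulr0 addr0.
  apply: (@near_eq_is_derive _ _ _ (cst 0)).
    by near=> s; rewrite flat_le0// ltW//; near: s; exact: lt_nbhsl.
- apply: (@near_eq_is_derive _ _ _ ((fun u => u ^+ k * expR (- u)) \o (fun t => t^-1))).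
    near=> s; rewrite /flat ifT//; near: s; exact: lt_nbhsr.
  have d1 : is_derive t 1 (fun t : R => t^-1) (- t ^- 2).
    apply: DeriveDef.
      by apply: (@derivableV _ _ id); [exact: lt0r_neq0|exact: derivable_id].
    have tn0 := lt0r_neq0 t0.
    rewrite (@deriveV _ _ id) ?derive_id//.
    by rewrite /GRing.scale/= mulr1.
  have d2 (u : R) : is_derive u 1 (fun u => u ^+ k * expR (- u))
     (k%:R * u ^+ k.-1 * expR (- u) - u ^+ k * expR (- u)).
    have dX := is_deriveX k (is_derive_id u (1 : R)).
    have dE := is_derive1_comp (is_derive_expR (- u)) (is_deriveNid u (1 : R)).
    have := is_deriveM dX dE.
    rewrite /GRing.scale/= !mulr1 mulrN1 mulrN addrC (mulrC (expR _)).
    have powE v : (id ^+ k : R -> R) v = v ^+ k by rewrite fctE.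
    rewrite powE (_ : id ^+ k * _ = (fun u => u ^+ k * expR (- u)))//.
    by apply/funext => v; rewrite -powE.
  have := is_derive1_comp (d2 t^-1) d1.
  rewrite /flat t0 -exprVn; congr is_derive.
  (* At [k = 0] the truncated exponent [k.-1] is harmless, its coefficient being 0. *)
  case: k {d2} => [|k] /=; first by rewrite !mul0r oppr0 !expr0 expr1; ring.
  by rewrite !exprS; ring.
- rewrite !flat_le0// mulr0 addr0.
  apply: (@is_derive_quadratic _ (k.+2)`!%:R) => x.
  by rewrite ger0_norm ?flat_ge0// flat_sqr.
Unshelve. all: by end_near. Qed.

Lemma Cn_flat n k : Cn n (flat k).
Proof.
elim: n k => [//|n ih] k; split; first by move=> x; have [] := is_derive_flat k x.
rewrite (_ : derive1 _ = fun x => - k%:R * flat k.+1 x + flat k.+2 x).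
  by apply: CnD => //; apply: CnM => //; exact: Cn_cst.
by apply/funext => x; rewrite derive1E; have [] := is_derive_flat k x.
Qed.

Lemma smooth_flat k : smooth (flat k).
Proof. by apply: Cn_smooth => n; exact: Cn_flat. Qed.

Lemma cvg_flat (x_ : R^nat) : x_ n @[n --> \oo] --> +oo ->
  flat 0 (x_ n) @[n --> \oo] --> (1 : R).
Proof.
move=> xoo.
have h : expR (- (x_ n)^-1) @[n --> \oo] --> (1 : R).
  rewrite -[X in _ --> X]expR0.
  apply: (@cvg_comp _ _ _ (fun n => - (x_ n)^-1) expR _ (nbhs (0 : R)));
    last exact: continuous_expR.
  rewrite -oppr0; apply: cvgN; apply/gtr0_cvgV0 => //.
  by move/cvgryPgt : xoo; exact.
apply: cvg_trans h; apply: near_eq_cvg.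
near=> n; rewrite /flat ifT ?expr0 ?mul1r//.
by near: n; move/cvgryPgt : xoo; exact.
Unshelve. all: by end_near. Qed.

(** The arguments are n (x - a) - 1 and n (q - x), written in the form required by [smooth_affine].
    The shift by -1 keeps the support at distance 1/n from [a], the end of the interval; at [q],
    which is always taken below [b], no margin is left. *)
Definition bump (a q : R) n (x : R) : R :=
  flat 0 (n%:R * x + (- n%:R * a - 1)) * flat 0 (- n%:R * x + n%:R * q).

Lemma smooth_bump a q n : smooth (bump a q n).
Proof. by apply: smoothM; apply: smooth_affine; exact: smooth_flat. Qed.

Lemma bump_ge0 a q n x : 0 <= bump a q n x.
Proof. by rewrite mulr_ge0 ?flat_ge0. Qed.

Lemma bump_le1 a q n x : bump a q n x <= 1.
Proof. by rewrite -[leRHS]mulr1 ler_pM ?flat_ge0 ?flat0_le1. Qed.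

Lemma bump_eq0 a q n x : ~~ (a + n.+1%:R^-1 < x < q) -> bump a q n.+1 x = 0.
Proof.
rewrite negb_and -!leNgt => /orP[xa|qx].
  rewrite /bump [X in X * _]flat_le0 ?mul0r//.
  rewrite mulNr addrA -mulrBr subr_le0 mulrC -ler_pdivlMr//.
  by rewrite mul1r lerBlDl.
rewrite /bump [X in _ * X]flat_le0 ?mulr0//.
by rewrite mulNr addrC -mulrBr pmulr_rle0// subr_le0.
Qed.

Lemma cvg_bump a q x :
  bump a q n x @[n --> \oo] --> (\1_(`]a, q[%classic) x : R).
Proof.
rewrite indicE; case: (boolP (x \in _)) => [|].
  rewrite inE/= in_itv/= => /andP[ax xq].
  rewrite -[X in _ --> X]mulr1; apply: cvgM; apply: cvg_flat.
    rewrite (_ : (fun n => _) = fun n => (x - a) * n%:R - 1); last first.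
      by apply/funext => n; ring.
    apply/cvgryPge => A; near=> n.
    rewrite lerBrDr mulrC -ler_pdivrMr ?subr_gt0//.
    by near: n; exact: nbhs_infty_ger.
  rewrite (_ : (fun n => _) = fun n => (q - x) * n%:R); last first.
    by apply/funext => n; ring.
  apply/cvgryPge => A; near=> n.
  rewrite mulrC -ler_pdivrMr ?subr_gt0//.
  by near: n; exact: nbhs_infty_ger.
rewrite notin_setE/= in_itv/= => /negP h.
apply: (@cvg_trans _ ((fun=> 0) @ \oo)); last exact: cvg_cst.
apply: near_eq_cvg; near=> n.
rewrite -(@prednK n); last by near: n; exists 1%N.
rewrite bump_eq0//; apply: contra h => /andP[h ->]; rewrite andbT.
by apply: le_lt_trans h; rewrite lerDl.
Unshelve. all: by end_near. Qed.

End flat_function.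

(** * Test functions through bounds on their support, and their primitives *)

Section test_functions.
Context {R : realType}.
Notation mu := (@lebesgue_measure R).

Lemma Cc_inftyP (a b c d : R) (f : R -> R) : a < c -> d < b -> smooth f ->
  (forall x, ~~ (c <= x <= d) -> f x = 0) -> Cc_infty `]a, b[ f.
Proof.
move=> ac db sf f0.
have sub : closure [set x | f x != 0] `<=` `[c, d].
  rewrite (closure_id `[c, d]%classic).1; last exact: itv_closed.
  apply: closure_subset => x /= fx; rewrite in_itv/=.
  by apply: contraNT fx => /f0 ->.
split=> //.
  apply: subclosed_compact sub; first exact: closed_closure.
  exact: segment_compact.
apply: subset_trans sub _ => x /=; rewrite !in_itv/= => /andP[cx xd].
by rewrite (lt_le_trans ac cx) (le_lt_trans xd db).
Qed.

(** [c] and [d] are the extrema of the compact support; an empty support is given the midpoint of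
    the interval. *)
Lemma Cc_infty_bounds (a b : R) (f : R -> R) : a < b -> Cc_infty `]a, b[ f ->
  exists c d, [/\ a < c, d < b & forall x, ~~ (c <= x <= d) -> f x = 0].
Proof.
move=> ab [_ + +]; set S := [set x | _] => cK KD.
have [/eqP S0|/set0P S0] := boolP (S == set0).
  exists ((a + b) / 2), ((a + b) / 2); split; [lra|lra|] => x _.
  apply/eqP; apply: contraT => fx; have : S x by [].
  by rewrite S0.
have K0 : closure S !=set0.
  by case: S0 => x Sx; exists x; exact: subset_closure.
have cid : {within closure S, continuous (id : R -> R)}.
  by apply: continuous_subspaceT => x; exact: cvg_id.
have [d dK dmax] := compact_EVT_max K0 cK cid.
have [c cK' cmin] := compact_EVT_min K0 cK cid.
move: (dK) (cK'); rewrite !inE => /KD /=; rewrite in_itv/= => /andP[_ db].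
move=> /KD /=; rewrite in_itv/= => /andP[ac _].
exists c, d; split => // x; apply: contraNeq => fx.
have xK : x \in closure S by rewrite inE; exact: subset_closure.
by apply/andP; split; [exact: cmin|exact: dmax].
Qed.

Lemma integrable_of_support (c d : R) (f : R -> R) : continuous f ->
  (forall x, ~~ (c <= x <= d) -> f x = 0) -> mu.-integrable [set: R] (EFin \o f).
Proof.
move=> cf f0.
have := @continuous_compact_integrable R f `[c, d] (@segment_compact _ c d).
move=> /(_ (continuous_subspaceT cf)).
have mI : measurable (`[c, d]%classic : set (measurableTypeR R)).
  exact: measurable_itv.
move=> h; have {h} := (integrable_mkcond _ mI).1 h.
apply: eq_integrable => // x _; rewrite patchE; case: ifPn => //.
by rewrite notin_setE/= in_itv/= => /negP /f0 /= ->.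
Qed.

(** The primitive taken from -oo vanishes to the left of [c] by construction, and to the right of
    [d] because [psi] has integral 0. *)
Lemma primitive_Cc_infty (a b c d : R) (psi : R -> R) : a < c -> d < b ->
  smooth psi -> (forall x, ~~ (c <= x <= d) -> psi x = 0) ->
  \int[mu]_x psi x = 0 ->
  exists2 phi, Cc_infty `]a, b[ phi & derive1 phi = psi.
Proof.
move=> ac db spsi psi0 ipsi.
have ip : mu.-integrable [set: R] (EFin \o psi).
  exact: integrable_of_support (smooth_continuous spsi) psi0.
pose phi x := \int[mu]_(t in `]-oo, x]) psi t.
have dphi x : derivable phi x 1 /\ derive1 phi x = psi x.
  apply: (@continuous_FTC1 _ _ -oo%O _ (x + 1)) => //; first by rewrite ltrDl.
  - exact: integrableS ip.
  - by rewrite ltNyr.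
  - exact: smooth_continuous.
have E : derive1 phi = psi by apply/funext => x; case: (dphi x).
exists phi; last exact: E.
apply: (Cc_inftyP ac db).
  by apply: smooth_of_derive1; [move=> x; case: (dphi x)|rewrite E].
move=> x; rewrite negb_and -!ltNge => /orP[xc|dx].
  rewrite /phi /Rintegral integral0_eq// => t /=; rewrite in_itv/= => tx.
  by rewrite psi0// negb_and -!ltNge (le_lt_trans tx xc).
rewrite /phi -ipsi [RHS]/Rintegral -/(Rintegral _ _ _) Rintegral_mkcond.
apply: eq_Rintegral => t _; rewrite patchE; case: ifPn => //.
rewrite notin_setE/= in_itv/= => /negP; rewrite -ltNge => xt.
by rewrite psi0// negb_and -!ltNge (lt_trans dx xt) orbT.
Qed.

End test_functions.

(** * The du Bois-Reymond lemma *)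

Section du_bois_reymond.
Context {R : realType}.
Notation mu := (@lebesgue_measure R).

Lemma cvg_succ (u : R^nat) (l : R) :
  u n @[n --> \oo] --> l -> u n.+1 @[n --> \oo] --> l.
Proof. by rewrite cvg_shiftS. Qed.

Lemma measurable_bump (a q : R) n : measurable_fun [set: R] (bump a q n).
Proof. by apply: continuous_measurable_fun; exact/smooth_continuous/smooth_bump. Qed.

Lemma bump_norm_le1 (a q : R) n x : `|bump a q n x| <= 1.
Proof. by rewrite ger0_norm ?bump_ge0// bump_le1. Qed.

Lemma integrable_indicM (g : R -> R) (A : set R) : measurable A ->
  mu.-integrable [set: R] (EFin \o g) ->
  mu.-integrable [set: R] (fun x => (\1_A x * g x)%:E).
Proof.
move=> mA; apply: (@integrable_bounded_mul _ _ _ 1) => //.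
by move=> x; rewrite ger0_norm ?indicE ?ler0n// lern1; case: (_ \in _).
Qed.

Lemma cvg_integral_bump (g : R -> R) (a q : R) :
  mu.-integrable [set: R] (EFin \o g) ->
  \int[mu]_x (bump a q n x * g x) @[n --> \oo] -->
  \int[mu]_x (\1_(`]a, q[%classic) x * g x).
Proof.
move=> ig.
have mg : measurable_fun [set: R] g.
  by apply/measurable_EFinP; exact: measurable_int ig.
have mF n : measurable_fun [set: R] (fun x => (bump a q n x * g x)%:E).
  by apply/measurable_EFinP; apply: measurable_funM => //; exact: measurable_bump.
have mI : measurable_fun [set: R] (fun x => (\1_(`]a, q[%classic) x * g x)%:E).
  by apply/measurable_EFinP; apply: measurable_funM.
have [|||_ _] := @dominated_convergence _ _ _ mu [set: R] measurableT
  (fun n x => (bump a q n x * g x)%:E) (fun x => (\1_(`]a, q[%classic) x * g x)%:E)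
  (fun x => `|(g x)%:E|%E) mF mI.
- apply: aeW => x _; apply: cvg_EFin; first exact: nearW.
  by apply: cvgMl; exact: cvg_bump.
- exact: integrable_abse.
- apply: aeW => x n _; rewrite EFinM abseM -[leRHS]mul1e lee_wpmul2r//.
  by rewrite lee_fin bump_norm_le1.
move=> h; apply: fine_cvg; rewrite /Rintegral fineK//.
by apply: integrable_fin_num => //; exact: integrable_indicM.
Qed.

(** By Lebesgue differentiation the primitive has derivative [h] almost everywhere, and it vanishes
    near every point of []a, b[]. *)
Lemma ae0_of_primitive (a b : R) (h : R -> R) :
  mu.-integrable [set: R] (EFin \o h) ->
  (forall q, a < q < b -> \int[mu]_(x in `]-oo, q]) h x = 0) ->
  {ae mu, forall x, a < x < b -> h x = 0}.
Proof.
move=> ih h0.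
have lh : locally_integrable [set: R] h by apply: open_integrable_locally => //; exact: openT.
have iN y : mu.-integrable `]-oo, y] (EFin \o h) by exact: integrableS ih.
have := FTC1Ny iN lh.
apply: filterS; first exact: (ae_filter_ringOfSetsType mu).
move=> x /= [_ <-] axb; rewrite derive1E.
rewrite (@near_eq_derive _ _ _ _ (cst 0)) ?derive_cst//.
near=> y; apply: h0; apply/andP; split; near: y;
  [apply: lt_nbhsr|apply: lt_nbhsl]; by case/andP: axb.
Unshelve. all: by end_near. Qed.

(* Only the test functions phi whose derivative is a bump approximating the
   indicator of ]a, q[, corrected by a multiple of a fixed bump to have integral
   0, are used. *)
Lemma du_bois_reymond (a b : R) (h : R -> R) : a < b ->
  mu.-integrable [set: R] (EFin \o h) ->
  (forall phi, Cc_infty `]a, b[ phi -> \int[mu]_x (derive1 phi x * h x) = 0) ->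
  exists c, {ae mu, forall x, a < x < b -> h x = c}.
Proof.
move=> ab ih hphi.
have i1 q : mu.-integrable [set: R] (EFin \o \1_(`]a, q[%classic)).
  exact: integrable_indic_itv.
have ib g n q : mu.-integrable [set: R] (EFin \o g) ->
    mu.-integrable [set: R] (fun x => (bump a q n x * g x)%:E).
  by apply: (@integrable_bounded_mul _ _ _ 1); [exact: measurable_bump|exact: bump_norm_le1].
have Ib n q : bump a q n.+1 = fun x => bump a q n.+1 x * \1_(`]a, q[%classic) x.
  apply/funext => x; rewrite indicE; case: (boolP (x \in _)); rewrite ?mulr1//.
  rewrite notin_setE/= in_itv/= => /negP xaq; rewrite mulr0 bump_eq0//.
  apply: contra xaq => /andP[ax ->]; rewrite andbT.
  by apply: le_lt_trans ax; rewrite lerDl.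
have intb n q : mu.-integrable [set: R] (EFin \o bump a q n.+1).
  by rewrite Ib; exact: ib.
pose q0 := (a + b) / 2.
have aq0 : a < q0 by rewrite /q0; lra.
have q0b : q0 < b by rewrite /q0; lra.
(* The integrals of the bumps tend to [q0 - a > 0], so one of them is positive and can serve as the
   fixed correction. *)
have [n0 In0] : exists n0, 0 < \int[mu]_x bump a q0 n0.+1 x.
  have := @cvg_integral_bump \1_(`]a, q0[%classic) a q0 (i1 _).
  rewrite (_ : \int[mu]_x (_ * _) = q0 - a); last first.
    rewrite (_ : (fun x => _) = \1_(`]a, q0[%classic)); last first.
      by apply/funext => x; rewrite indicE; case: (_ \in _); rewrite ?mulr1 ?mulr0.
    rewrite /Rintegral integral_indic// setIT.
    rewrite -[X in fine X]/(mu `]a, q0[%classic) lebesgue_measure_itv/= lte_fin aq0.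
    by rewrite -EFinB.
  move/cvgrPdist_lt => /(_ (q0 - a)); rewrite subr_gt0 => /(_ aq0)[N _ /(_ N.+1)/=].
  move=> /(_ (leqnSn N)) hN; exists N.
  rewrite Ib; rewrite ltr_distlC in hN.
  by case/andP: hN => + _; rewrite subrr.
pose th := bump a q0 n0.+1.
pose Ith := \int[mu]_x th x.
(* The weighted mean of [h] against [th]: the only value that a constant [h] could have. *)
pose c := (\int[mu]_x (th x * h x)) / Ith.
exists c.
have key n q : a < q < b ->
    \int[mu]_x (bump a q n.+1 x * h x) = c * \int[mu]_x bump a q n.+1 x.
  move=> /andP[aq qb].
  set Ip := \int[mu]_x bump a q n.+1 x.
  pose k := Ip / Ith.
  pose psi x := bump a q n.+1 x + (- k) * th x.
  have [|||||phi cphi dphi] := @primitive_Cc_infty _ a b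
      (Num.min (a + n.+1%:R^-1) (a + n0.+1%:R^-1)) (Num.max q q0) psi.
  - by rewrite lt_min !ltrDl !invr_gt0 !ltr0n.
  - by rewrite gt_max qb.
  - apply: smoothD; first exact: smooth_bump.
    by apply: smoothM; [exact: smooth_cst|exact: smooth_bump].
  - move=> x; rewrite ge_min le_max => hx; rewrite /psi /th !bump_eq0 ?mulr0 ?addr0//.
      by apply: contra hx => /andP[/ltW -> /ltW ->]; rewrite !orbT.
    by apply: contra hx => /andP[/ltW -> /ltW ->].
  - have ikth : mu.-integrable [set: R] (EFin \o (fun x => - k * th x)).
      exact: integrableZl (intb _ _).
    rewrite (RintegralD measurableT (intb n q) ikth) (RintegralZl _ measurableT (intb _ _)).
    by rewrite -/Ip -/Ith /k mulNr divfK ?subrr// gt_eqF.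
  have := hphi _ cphi; rewrite dphi /psi.
  under eq_Rintegral do rewrite mulrDl -(mulrA (- k)).
  have ith : mu.-integrable [set: R] (EFin \o (fun x => th x * h x)) := ib _ _ _ ih.
  have ikth : mu.-integrable [set: R] (EFin \o (fun x => - k * (th x * h x))).
    exact: integrableZl ith.
  have ibh : mu.-integrable [set: R] (EFin \o (fun x => bump a q n.+1 x * h x)).
    exact: ib.
  rewrite (RintegralD measurableT ibh ikth) (RintegralZl _ measurableT ith).
  move/eqP; rewrite addr_eq0 mulNr opprK => /eqP ->.
  by rewrite /k /c; ring.
(* Truncation to []a, b[] makes the constant integrable. *)
have intc : mu.-integrable [set: R] (fun x => (\1_(`]a, b[%classic) x * (h x - c))%:E).
  under eq_fun do rewrite mulrBr EFinB.
  apply: integrableB => //; first exact: integrable_indicM.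
  under eq_fun do rewrite mulrC EFinM.
  by apply: integrableZl => //; exact: integrable_indic_itv.
have := @ae0_of_primitive a b (fun x => \1_(`]a, b[%classic) x * (h x - c)) intc.
move=> /(_ _)/wrap[q /andP[aq qb]|].
  have e1 := @cvg_integral_bump h a q ih.
  (* The limit theorem asks for an integrable factor, which the constant 1 is not; by [Ib] the
     indicator of []a, q[] can take its place. *)
  have e2 := @cvg_integral_bump _ a q (i1 q).
  have {}e2 : c * \int[mu]_x (bump a q n.+1 x * \1_(`]a, q[%classic) x) @[n --> \oo] -->
      c * \int[mu]_x (\1_(`]a, q[%classic) x * \1_(`]a, q[%classic) x).
    exact: cvgMr (cvg_succ e2).
  have {}e1 := cvg_succ e1.
  have e12 : \int[mu]_x (\1_(`]a, q[%classic) x * h x) =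
      c * \int[mu]_x (\1_(`]a, q[%classic) x * \1_(`]a, q[%classic) x).
    rewrite -(cvg_lim (@Rhausdorff R) e1) -(cvg_lim (@Rhausdorff R) e2).
    congr (lim (_ @ \oo)); apply/funext => n.
    by rewrite key ?aq// [in LHS]Ib.
  rewrite -Rintegral_itv_bndo_bndc; last exact: integrableS intc.
  rewrite Rintegral_mkcond.
  rewrite [LHS](_ : _ = \int[mu]_x (\1_(`]a, q[%classic) x * h x - c * (\1_(`]a, q[%classic) x * \1_(`]a, q[%classic) x))).
    rewrite RintegralB ?RintegralZl ?e12 ?subrr//.
    - exact: integrable_indicM.
    - exact: integrable_indicM.
    - rewrite /comp; under eq_fun do rewrite EFinM.
      by apply: integrableZl => //; exact: integrable_indicM.
  apply: eq_Rintegral => x _; rewrite patchE; case: ifPn => [|].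
    rewrite inE/= in_itv/= => xq.
    rewrite !indicE !mem_setE/= !in_itv/= xq andbT (lt_trans xq qb) andbT.
    by case: (a < x); rewrite ?mul1r ?mulr1 ?mul0r ?mulr0 ?subr0.
  rewrite notin_setE/= in_itv/= => /negP/negbTE xq.
  by rewrite !indicE !mem_setE/= !in_itv/= xq andbF !mul0r mulr0 subr0.
apply: filterS; first exact: (ae_filter_ringOfSetsType mu).
move=> x /= hx axb; have := hx axb.
rewrite indicE mem_set/= ?in_itv/= ?mul1r// => /eqP.
by rewrite subr_eq0 => /eqP.
Qed.

End du_bois_reymond.

(** * Fractional derivatives of test functions *)

Section frac_der_test.
Context {R : realType}.
Notation mu := (@lebesgue_measure R).
Implicit Types (a b c d s x : R) (f phi : R -> R).

Lemma bounded_of_support f c d : continuous f ->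
  (forall x, ~~ (c <= x <= d) -> f x = 0) -> exists M : R, forall x, `|f x| <= M.
Proof.
move=> cf f0; have [cd|dc] := leP c d; last first.
  exists 0 => x; rewrite f0 ?normr0//; apply/negP => /andP[cx xd].
  by have := lt_le_trans dc (le_trans cx xd); rewrite ltxx.
have cnf : continuous (fun x => `|f x|).
  by move=> x; apply: cvg_norm; exact: cf.
have [m mcd mmax] := EVT_max cd (continuous_subspaceT cnf).
exists `|f m| => x; have [xcd|/f0 ->] := boolP (c <= x <= d).
  by apply: mmax; rewrite in_itv.
by rewrite normr0.
Qed.

Lemma derive1_support f c d : (forall x, ~~ (c <= x <= d) -> f x = 0) ->
  forall x, ~~ (c <= x <= d) -> derive1 f x = 0.
Proof.
move=> f0 x xcd; rewrite derive1E (@near_eq_derive _ _ _ _ (cst 0)) ?derive_cst//.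
move: xcd; rewrite negb_and -!ltNge => /orP[xc|dx]; near=> y; apply: f0;
  rewrite negb_and -!ltNge; apply/orP; [left|right]; near: y;
  [exact: lt_nbhsl|exact: lt_nbhsr].
Unshelve. all: by end_near. Qed.

Lemma integrable_pker_trunc s (T : R) : 0 < s ->
  mu.-integrable [set: R] (fun t => (pker 1 (T - t) * pker s t)%:E).
Proof.
move=> s0; apply/integrableP; split.
  apply/measurable_EFinP; apply: measurable_funM; last exact: measurable_pker.
  by apply: measurable_pkerB; exact: measurable_funB.
under eq_integral => t _ do rewrite gee0_abs ?lee_fin ?mulr_ge0 ?pker_ge0// -{2}(subr0 t).
by rewrite pker_conv -(fineK (pbeta_fin_num ltr01 s0)) -EFinM ltry.
Qed.

Lemma integrable_pker_shift s x f d M : 0 < s -> measurable_fun [set: R] f ->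
  (forall y, `|f y| <= M) -> (forall y, d < y -> f y = 0) ->
  mu.-integrable [set: R] (fun t => (pker s t * f (x + t))%:E).
Proof.
move=> s0 mf fM f0.
have ik := @integrable_pker_trunc s (d - x + 1) s0.
have mfx : measurable_fun [set: R] (fun t => f (x + t)).
  by apply: measurableT_comp => //; exact: measurable_funD.
have := @integrable_bounded_mul _ (fun t => f (x + t)) _ M mfx (fun t => fM _) ik.
apply: eq_integrable => // t _; congr EFin.
have [tT|Tt] := ltP t (d - x + 1).
  by rewrite pker1 subr_gt0 tT mul1r mulrC.
by rewrite f0 ?mul0r ?mulr0//; lra.
Qed.

Lemma frac_int_rightE b s f x :
  frac_int_right b s f x =
  (Gamma s)^-1 * \int[mu]_y (pker s (y - x) * (f \_ `]-oo, b[) y).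
Proof.
rewrite /frac_int_right; congr (_ * _).
rewrite Rintegral_mkcond; apply: eq_Rintegral => y _; rewrite !patchE.
have [xy|yx] := ltP x y; last first.
  by rewrite pker_le0 ?subr_le0// mul0r memNset//= in_itv/= ltNge yx.
have [yb|by_] := ltP y b; last first.
  by rewrite !memNset/= ?mulr0// in_itv/= ?xy ltNge by_.
rewrite !mem_set/= ?in_itv/= ?xy ?yb// pker_gt0 ?subr_gt0// mulrC -powRN.
by rewrite opprB.
Qed.

Lemma Rintegral_shift f x : measurable_fun [set: R] f ->
  \int[mu]_t f (x + t) = \int[mu]_t f t.
Proof.
move=> mf; rewrite /Rintegral; congr fine.
under eq_integral do rewrite addrC.
rewrite (@integral_shift _ x (EFin \o f))//.
exact/measurable_EFinP.
Qed.

(** In this translated form the variable sits in the smooth factor and not in the singular kernel,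
    so that differentiation under the integral applies. *)
Lemma is_derive_pker_shift s x phi c d : 0 < s -> smooth phi ->
  (forall x, ~~ (c <= x <= d) -> phi x = 0) ->
  is_derive x 1 (fun x => \int[mu]_t (pker s t * phi (x + t)))
    (\int[mu]_t (pker s t * derive1 phi (x + t))).
Proof.
move=> s0 sphi phi0.
have cphi := smooth_continuous sphi.
have cphi' := smooth_continuous (smooth_derive1 sphi).
have phi'0 := derive1_support phi0.
have [M phiM] := bounded_of_support cphi phi0.
have [M' phiM'] := bounded_of_support cphi' phi'0.
have mphi := continuous_measurable_fun cphi.
have out (f : R -> R) (y : R) : (forall x, ~~ (c <= x <= d) -> f x = 0) -> d < y -> f y = 0.
  by move=> f0 dy; apply: f0; rewrite negb_and -!ltNge dy orbT.
pose f (x t : R) := pker s t * phi (x + t).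
have df (y t : R) : is_derive y 1 (f ^~ t) (pker s t * derive1 phi (y + t)).
  have dphi : is_derive (y + t) 1 phi (derive1 phi (y + t)).
    by apply: DeriveDef; [exact: smooth_derivable|rewrite derive1E].
  have dD : is_derive y 1 (fun y : R => y + t) (1 : R).
    have := is_deriveD (is_derive_id y (1 : R)) (is_derive_cst t y (1 : R)).
    by rewrite addr0.
  have := is_deriveZ (pker s t) (@is_derive1_comp _ phi (fun y => y + t) y _ _ dphi dD).
  by rewrite mulr1.
have dfE (y t : R) : partial1of2 f y t = pker s t * derive1 phi (y + t).
  by rewrite partial1of2E; have [] := df y t.
(* For every [y] within 1 of [x], [derive1 phi (y + t)] vanishes once [t >= d - x + 2]; the kernel
   cut off there dominates uniformly. *)
pose G (t : R) := M' * (pker 1 (d - x + 2 - t) * pker s t).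
have M'0 : 0 <= M' by apply: le_trans (phiM' 0).
have G0 (t : R) : 0 <= G t by rewrite !mulr_ge0 ?pker_ge0.
have iG : mu.-integrable [set: R] (EFin \o G).
  exact: integrableZl (integrable_pker_trunc _ s0).
have xI : `](x - 1), (x + 1)[%classic x by rewrite /= in_itv/=; lra.
have intf (y : R) : `](x - 1), (x + 1)[%classic y -> mu.-integrable [set: R] (EFin \o f y).
  by move=> _; apply: integrable_pker_shift mphi phiM _ => // z; exact: out.
have df' (y t : R) : `](x - 1), (x + 1)[%classic y -> [set: R] t -> derivable (f ^~ t) y 1.
  by move=> _ _; have [] := df y t.
have Gub (y t : R) : `](x - 1), (x + 1)[%classic y -> [set: R] t -> `|partial1of2 f y t| <= G t.
  rewrite /= in_itv/= => /andP[y1 y2] _.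
  rewrite dfE normrM (ger0_norm (pker_ge0 _ _)) /G.
  have [tT|Tt] := ltP t (d - x + 2).
    rewrite pker1 subr_gt0 tT mul1r mulrC ler_wpM2r ?pker_ge0//.
  have dyt : d < y + t by lra.
  by rewrite (out _ _ phi'0 dyt) normr0 mulr0 -/(G t) G0.
apply: DeriveDef.
  exact: (derivable_under_integral measurableT xI intf df' G0 iG Gub).
rewrite -derive1E (differentiation_under_integral measurableT xI intf df' G0 iG Gub).
by apply: eq_Rintegral => t _; rewrite dfE.
Qed.

(** The Caputo form of the derivative: it falls on [phi], and no boundary term appears since [phi]
    vanishes near [b]. *)
Lemma is_derive_frac_int_right a b s phi x : a < b -> 0 < s ->
  Cc_infty `]a, b[ phi ->
  is_derive x 1 (frac_int_right b s phi)
    ((Gamma s)^-1 * \int[mu]_y (pker s (y - x) * derive1 phi y)).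
Proof.
move=> ab s0 cphi; have [sphi _ _] := cphi.
have [c [d [ac db phi0]]] := Cc_infty_bounds ab cphi.
have msh (f : R -> R) (y : R) : measurable_fun [set: R] f ->
    \int[mu]_t (pker s t * f (y + t)) = \int[mu]_t (pker s (t - y) * f t).
  move=> mf; rewrite -[RHS](@Rintegral_shift _ y).
    by apply: eq_Rintegral => t _; rewrite addrAC subrr add0r.
  by apply: measurable_funM => //; apply: measurable_pkerB; exact: measurable_funB.
have mphi : measurable_fun [set: R] phi.
  by apply: continuous_measurable_fun; exact: smooth_continuous.
have mphi' : measurable_fun [set: R] (derive1 phi).
  by apply: continuous_measurable_fun; exact/smooth_continuous/smooth_derive1.
have -> : frac_int_right b s phi =
    fun x => (Gamma s)^-1 * \int[mu]_t (pker s t * phi (x + t)).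
  apply/funext => y; rewrite frac_int_rightE msh//; congr (_ * _).
  apply: eq_Rintegral => t _; congr (_ * _); rewrite patchE.
  case: ifPn => //; rewrite notin_setE/= in_itv/= => /negP; rewrite -leNgt => bt.
  by rewrite phi0// negb_and -!ltNge (lt_le_trans db bt) orbT.
rewrite -msh//.
have D := is_deriveZ (Gamma s)^-1 (@is_derive_pker_shift s x phi c d s0 sphi phi0).
exact: D.
Qed.

Lemma frac_der_rightE a b alpha phi x : a < b -> alpha < 1 ->
  Cc_infty `]a, b[ phi ->
  frac_der_right b alpha phi x =
  - (Gamma (1 - alpha))^-1 * \int[mu]_y (pker (1 - alpha) (y - x) * derive1 phi y).
Proof.
move=> ab a1 cphi; have s0 : 0 < 1 - alpha by rewrite subr_gt0.
rewrite /frac_der_right mulNr; congr (- _); rewrite derive1E.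
by have [_ ->] := is_derive_frac_int_right x ab s0 cphi.
Qed.

End frac_der_test.

(** * Riemann-Liouville integrals: semigroup law and duality *)

Section riemann_liouville.
Context {R : realType}.
Notation mu := (@lebesgue_measure R).
Implicit Types (a b c s r x y z : R) (f g : R -> R).

Lemma fineZl c (X : \bar R) : 0 <= c -> fine (c%:E * X) = c * fine X.
Proof.
rewrite le_eqVlt => /predU1P[<-|c0]; first by rewrite mul0e mul0r.
by case: X => [X//| |]; rewrite ?gt0_muley ?gt0_muleNy ?lte_fin//= mulr0.
Qed.

Lemma muleBr_ge0 c (X Y : \bar R) : 0 <= c -> (0 <= X)%E -> (0 <= Y)%E ->
  (c%:E * (X - Y) = c%:E * X - c%:E * Y)%E.
Proof.
rewrite le_eqVlt => /predU1P[<-|c0]; first by rewrite !mul0e subee.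
case: X => [X| |]; case: Y => [Y| |] //= _ _;
  rewrite ?gt0_muley ?gt0_muleNy ?lte_fin//.
by rewrite -EFinB -!EFinM -EFinB mulrBr.
Qed.

(** When the integral of [f] is infinite both sides are 0 by the convention of [fine]. Kernels can
    therefore be pulled out of inner integrals at every point, though convergence is known only
    almost everywhere. *)
Lemma RintegralZl_ge0 c f : 0 <= c -> measurable_fun [set: R] f ->
  \int[mu]_x (c * f x) = c * \int[mu]_x f x.
Proof.
move=> c0 mf; rewrite /Rintegral.
have mE : measurable_fun [set: R] (EFin \o f) by exact/measurable_EFinP.
under eq_integral do rewrite EFinM.
have -> : (\int[mu]_x (c%:E * (f x)%:E) = c%:E * \int[mu]_x (f x)%:E)%E.
  rewrite integralE [in RHS]integralE.
  under eq_integral do rewrite ge0_funeposM//.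
  under [X in (_ - X)%E]eq_integral do rewrite ge0_funenegM//.
  rewrite !ge0_integralZl//; [|exact: measurable_funeneg|exact: measurable_funepos].
  by rewrite -muleBr_ge0// integral_ge0.
exact: fineZl.
Qed.

(* Riemann-Liouville integral without the factor 1 / Gamma s: the constants are
   then carried by pbeta, and no relation between Gamma and beta is needed. *)
Definition RL s f x : R := \int[mu]_y (pker s (x - y) * f y).

Lemma measurable_pker_prod s : measurable_fun [set: R * R] (fun w => pker s (w.1 - w.2)).
Proof.
apply: (measurableT_comp (measurable_pker s)).
apply: measurable_funB; [exact: measurable_fst|exact: measurable_snd].
Qed.

Lemma pker_monotone s x y : 1 <= s -> x <= y -> pker s x <= pker s y.
Proof.
move=> s1 xy; have [x0|x0] := leP x 0; first by rewrite pker_le0 ?pker_ge0.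
rewrite !pker_gt0 ?(lt_le_trans x0)//.
by apply: ge0_ler_powR => //; rewrite ?nnegrE ?subr_ge0 ?(ltW x0) ?(le_trans (ltW x0)).
Qed.

Lemma pker_conv_abs s r x z :
  (\int[mu]_y `|pker s (x - y) * pker r (y - z)|%:E =
   pbeta s r * (pker (s + r) (x - z))%:E)%E.
Proof.
rewrite -pker_conv; apply: eq_integral => y _.
by rewrite ger0_norm// mulr_ge0 ?pker_ge0.
Qed.

(** For 1 <= s + r the composed kernel is nondecreasing, so [z] may be replaced by the lower end [a]
    of the support. This supplies the uniform column bound for Fubini. *)
Lemma pker_conv_bound s r a x z : 0 < s -> 0 < r -> 1 <= s + r -> a < z ->
  (\int[mu]_y `|pker s (x - y) * pker r (y - z)|%:E <=
   (fine (pbeta s r) * pker (s + r) (x - a))%:E)%E.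
Proof.
move=> s0 r0 sr az.
rewrite pker_conv_abs -(fineK (pbeta_fin_num s0 r0)) -EFinM lee_fin.
rewrite ler_wpM2l ?fine_ge0 ?pbeta_ge0// pker_monotone//; lra.
Qed.

Lemma measurable_conv_kernel s r x : measurable_fun [set: R * R]
  (fun w => pker s (x - w.1) * pker r (w.1 - w.2)).
Proof.
apply: measurable_funM; last exact: measurable_pker_prod.
apply: (measurableT_comp (measurable_pker s)).
by apply: measurable_funB => //; exact: measurable_fst.
Qed.

Section composition.
Variables (a : R) (f : R -> R).
Hypotheses (if_ : mu.-integrable [set: R] (EFin \o f)) (f0 : forall y, y <= a -> f y = 0).
Variables (s r : R).
Hypotheses (s0 : 0 < s) (r0 : 0 < r) (sr : 1 <= s + r).

Let M x := fine (pbeta s r) * pker (s + r) (x - a).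

Let M0 x : 0 <= M x.
Proof. by rewrite mulr_ge0 ?pker_ge0 ?fine_ge0 ?pbeta_ge0. Qed.

Let mf : measurable_fun [set: R] f.
Proof. by apply/measurable_EFinP; exact: measurable_int if_. Qed.

Let KM x z : f z != 0 ->
  (\int[mu]_y `|pker s (x - y) * pker r (y - z)|%:E <= (M x)%:E)%E.
Proof.
move=> fz; apply: pker_conv_bound => //; rewrite ltNge; apply/negP => /f0 /eqP.
by rewrite (negbTE fz).
Qed.

Let inner x y : \int[mu]_z (pker s (x - y) * pker r (y - z) * f z) =
  pker s (x - y) * RL r f y.
Proof.
under eq_Rintegral do rewrite -mulrA.
rewrite RintegralZl_ge0 ?pker_ge0//; apply: measurable_funM => //.
by apply: measurable_pkerB; exact: measurable_funB.
Qed.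

Lemma integrable_pker_RL x :
  mu.-integrable [set: R] (fun y => (pker s (x - y) * RL r f y)%:E).
Proof.
have := @integrable_kernel_op R _ f (M x) (measurable_conv_kernel s r x) (M0 x) if_ (KM x).
by apply: eq_integrable => // y _; rewrite /= inner.
Qed.

(** The semigroup law: Fubini reduces it to [pker_conv]. It holds at every [x], not merely almost
    everywhere, because the composed kernel is bounded on the support of [f]. *)
Lemma RL_comp x : RL s (RL r f) x = fine (pbeta s r) * RL (s + r) f x.
Proof.
have := @fubini_kernel R _ f (M x) (measurable_conv_kernel s r x) (M0 x) if_ (KM x)
  (fun=> 1) 1 (@measurable_cst _ _ _ _ _ _).
move=> /(_ _)/wrap[_|]; first by rewrite normr1.
under eq_Rintegral do rewrite mul1r inner.
rewrite -[LHS]/(RL s (RL r f) x) => ->.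
rewrite /RL -RintegralZl_ge0 ?fine_ge0 ?pbeta_ge0//; last first.
  apply: measurable_funM => //; apply: measurable_pkerB; exact: measurable_funB.
apply: eq_Rintegral => z _; rewrite mulrA; congr (_ * _).
under eq_Rintegral do rewrite mul1r.
by rewrite /Rintegral pker_conv -(fineK (pbeta_fin_num s0 r0)).
Qed.

End composition.

Lemma integrable_RL s f a b : 0 < s ->
  mu.-integrable [set: R] (EFin \o f) -> (forall y, y <= a -> f y = 0) ->
  mu.-integrable [set: R] (fun x => (pker 1 (b - x) * RL s f x)%:E).
Proof. by move=> s0 if_ f0; apply: (integrable_pker_RL if_ f0) => //; lra. Qed.

Lemma RL_dual s f a b g N : 0 < s ->
  mu.-integrable [set: R] (EFin \o f) -> (forall y, y <= a -> f y = 0) ->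
  measurable_fun [set: R] g -> (forall x, `|g x| <= N) ->
  (forall x, b <= x -> g x = 0) ->
  \int[mu]_x (g x * RL s f x) =
  \int[mu]_y ((\int[mu]_x (g x * pker s (x - y))) * f y).
Proof.
move=> s0 if_ f0 mg gN g0.
have sr : 1 <= 1 + s by lra.
have M0 : 0 <= fine (pbeta 1 s) * pker (1 + s) (b - a).
  by rewrite mulr_ge0 ?pker_ge0 ?fine_ge0 ?pbeta_ge0.
have KM y : f y != 0 -> (\int[mu]_x `|pker 1 (b - x) * pker s (x - y)|%:E <=
    (fine (pbeta 1 s) * pker (1 + s) (b - a))%:E)%E.
  move=> fy; apply: pker_conv_bound => //; rewrite ltNge; apply/negP => /f0 /eqP.
  by rewrite (negbTE fy).
have mf : measurable_fun [set: R] f.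
  by apply/measurable_EFinP; exact: measurable_int if_.
(* This factor leaves [g] unchanged and turns [pker s (x - y)] into a convolution kernel of orders 1
   and [s], whose columns are bounded for [y > a]. *)
have gE x : g x * pker 1 (b - x) = g x.
  by rewrite pker1 subr_gt0; case: ltP => [_|/g0 ->]; rewrite ?mulr1 ?mul0r.
have := @fubini_kernel R _ f _ (measurable_conv_kernel 1 s b) M0 if_ KM g N mg gN.
rewrite (_ : (fun x => _) = (fun x => g x * RL s f x)); last first.
  apply/funext => x; under eq_Rintegral do rewrite -mulrA.
  rewrite RintegralZl_ge0 ?pker_ge0//; first by rewrite mulrA gE.
  apply: measurable_funM => //; apply: measurable_pkerB; exact: measurable_funB.
move=> ->; apply: eq_Rintegral => y _; congr (_ * _).
by apply: eq_Rintegral => x _; rewrite mulrA gE.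
Qed.

End riemann_liouville.

(** * Consequences of a left weak derivative for the primitive of u *)

Section representation.
Context {R : realType}.
Notation mu := (@lebesgue_measure R).
Implicit Types (a b c s r x y z : R) (f g : R -> R).

Lemma RintegralN_measurable f : measurable_fun [set: R] f ->
  \int[mu]_x (- f x) = - \int[mu]_x f x.
Proof.
move=> mf; rewrite /Rintegral.
have mE : measurable_fun [set: R] (EFin \o f) by exact/measurable_EFinP.
under eq_integral do rewrite EFinN.
rewrite integralE [in RHS]integralE.
under eq_integral do rewrite funeposN.
under [X in (_ - X)%E]eq_integral do rewrite funenegN.
move: (integral _ _ _) (integral _ _ _) => [x| |] [y| |] //=; rewrite ?oppr0//.
by rewrite opprB.
Qed.

Lemma RintegralZl_measurable c f : measurable_fun [set: R] f ->
  \int[mu]_x (c * f x) = c * \int[mu]_x f x.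
Proof.
move=> mf; have [c0|c0] := leP 0 c; first exact: RintegralZl_ge0.
rewrite -[in RHS](opprK c) mulNr -RintegralZl_ge0 ?oppr_ge0 ?ltW//.
rewrite -RintegralN_measurable; last exact: measurable_funM.
by apply: eq_Rintegral => x _; rewrite mulNr opprK.
Qed.

Lemma RL0 s f a x : (forall y, y <= a -> f y = 0) -> x <= a -> RL s f x = 0.
Proof.
move=> f0 xa; rewrite /RL /Rintegral integral0_eq// => y _.
have [ya|ay] := leP y a; first by rewrite f0// mulr0.
by rewrite pker_le0 ?mul0r// subr_le0 (le_trans xa)// ltW.
Qed.

(** The adjoint of J^1 maps - phi' back to phi; together with [RL_dual] at order 1 this converts the
    pairing of [v] with [phi] into one of J^1 v with phi'. *)
Lemma derive1_tail_integral phi c d y : smooth phi ->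
  (forall x, ~~ (c <= x <= d) -> phi x = 0) ->
  \int[mu]_x (- derive1 phi x * pker 1 (x - y)) = phi y.
Proof.
move=> sphi phi0.
pose T := Num.max y d + 1.
have yT : y <= T by rewrite /T; have := le_max y y d; rewrite lexx/=; lra.
have dT : d < T by rewrite /T; have := le_max d y d; rewrite lexx orbT; lra.
have phi'0 := derive1_support phi0.
have out (f : R -> R) (x : R) : (forall x, ~~ (c <= x <= d) -> f x = 0) -> d < x -> f x = 0.
  by move=> f0 dx; apply: f0; rewrite negb_and -!ltNge dx orbT.
have cphi' := smooth_continuous (smooth_derive1 sphi).
have cN : continuous (fun x => - derive1 phi x).
  by move=> x; apply: cvgN; exact: cphi'.
have iN : mu.-integrable `[y, T] (EFin \o (fun x => - derive1 phi x)).
  apply: continuous_compact_integrable; first exact: segment_compact.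
  exact: continuous_subspaceT.
transitivity (\int[mu]_(x in `]y, T]) (- derive1 phi x)).
  rewrite [RHS]Rintegral_mkcond; apply: eq_Rintegral => x _.
  rewrite patchE; case: ifPn => [|].
    by rewrite inE/= in_itv/= => /andP[yx _]; rewrite pker1 subr_gt0 yx mulr1.
  rewrite notin_setE/= in_itv/= => /negP; rewrite negb_and -leNgt -ltNge => /orP[xy|Tx].
    by rewrite pker_le0 ?mulr0// subr_le0.
  by rewrite (out _ _ phi'0) ?oppr0 ?mul0r// (lt_trans dT).
rewrite Rintegral_itv_obnd_cbnd; last first.
  by apply: integrableS iN => //; exact: subset_itv_oc_cc.
rewrite /Rintegral (@integral_derivative _ _ _ (fun x => - phi x))//.
- by rewrite (out phi T)//= oppr0 sub0r opprK.
- move=> x _; have dx : derivable phi x 1 by exact: smooth_derivable.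
  split; first exact: derivableN.
  by rewrite !derive1E deriveN.
- exact: continuous_subspaceT.
Qed.

Lemma patch_itvE f a b : f \_ `]a, b[ = fun x => if (a < x < b) then f x else 0.
Proof.
by apply/funext => x; rewrite patchE mem_setE /= in_itv/=.
Qed.

Section weak_left.
Variables (a b alpha : R) (u v : R -> R).
Hypotheses (ab : a < b) (alpha0 : 0 < alpha) (alpha1 : alpha < 1).
Hypothesis uv : weak_frac_der_left a b alpha u v.
Let u0 := u \_ `]a, b[.
Let v0 := v \_ `]a, b[.
Hypothesis iu : mu.-integrable [set: R] (EFin \o u0).
Hypothesis iv : mu.-integrable [set: R] (EFin \o v0).

Let s := 1 - alpha.
Let G := Gamma s.
Let s0 : 0 < s. Proof. by rewrite subr_gt0. Qed.
Let G0 : 0 < G. Proof. by apply: Gamma_gt0 => //; rewrite /s gerBl ltW. Qed.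

Let left0 f y : y <= a -> (f \_ `]a, b[) y = 0.
Proof. by move=> ya; rewrite patch_itvE ltNge ya. Qed.

(** Both sides of the weak identity become integrals against phi': the fractional derivative of phi
    is a kernel of order 1 - alpha applied to - phi', which duality moves onto [u0], and phi is the
    tail integral of - phi', which moves onto [v0]. The factor [pker 1 (b - x)] provides
    integrability on the line and changes nothing, as phi' vanishes from [b] on. *)
Lemma weak_left_test phi : Cc_infty `]a, b[ phi ->
  \int[mu]_x (derive1 phi x * (pker 1 (b - x) * (G^-1 * RL s u0 x - RL 1 v0 x))) = 0.
Proof.
move=> cphi; have [sphi _ _] := cphi.
have [c [d [ac db phi0]]] := Cc_infty_bounds ab cphi.
have phi'0 := derive1_support phi0.
have cphi' := smooth_continuous (smooth_derive1 sphi).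
have mphi' := continuous_measurable_fun cphi'.
have [M phiM] := bounded_of_support cphi' phi'0.
have phi'b x : b <= x -> derive1 phi x = 0.
  by move=> bx; apply: phi'0; rewrite negb_and -!ltNge (lt_le_trans db bx) orbT.
have M0 : 0 <= M by apply: le_trans (phiM 0).
have GiM x : `|- G^-1 * derive1 phi x| <= G^-1 * M.
  have Gi0 : 0 <= G^-1 by rewrite invr_ge0 ltW.
  by rewrite normrM normrN (ger0_norm Gi0) ler_wpM2l.
have E1 := @RL_dual R s u0 a b (fun x => - G^-1 * derive1 phi x) (G^-1 * M)
  s0 iu (left0 u) (measurable_funM (measurable_cst _) mphi') GiM.
have {}E1 : \int[mu]_x (- G^-1 * derive1 phi x * RL s u0 x) =
    \int[mu]_(x in `]a, b[) (v x * phi x).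
  rewrite E1; last by move=> x bx; rewrite phi'b ?mulr0.
  case: uv => _ _ /(_ _ cphi) ->; rewrite [RHS]Rintegral_mkcond.
  apply: eq_Rintegral => y _; rewrite /u0 !patchE; case: ifPn => _; last by rewrite mulr0.
  rewrite mulrC; congr (_ * _).
  rewrite (frac_der_rightE _ ab alpha1 cphi) -/s -/G.
  rewrite -RintegralZl_measurable.
    by apply: eq_Rintegral => x _; rewrite -mulrA (mulrC (pker _ _)).
  by apply: measurable_funM => //; apply: measurable_pkerB; exact: measurable_funB.
have NM x : `|- derive1 phi x| <= M by rewrite normrN.
have mN : measurable_fun [set: R] (fun x => - derive1 phi x) by exact: measurableT_comp.
have E2 : \int[mu]_x (- derive1 phi x * RL 1 v0 x) =
    \int[mu]_(x in `]a, b[) (v x * phi x).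
  rewrite (@RL_dual R 1 v0 a b (fun x => - derive1 phi x) M)//; last 2 first.
  - exact: left0.
  - by move=> x bx; rewrite phi'b ?oppr0.
  rewrite [RHS]Rintegral_mkcond; apply: eq_Rintegral => y _.
  rewrite (derive1_tail_integral _ sphi phi0) /v0 !patchE; case: ifPn => _; last by rewrite mulr0.
  exact: mulrC.
have iRLu : mu.-integrable [set: R] (EFin \o (fun x => - G^-1 * derive1 phi x * (pker 1 (b - x) * RL s u0 x))).
  apply: integrable_bounded_mul GiM _; first exact: measurable_funM.
  exact: integrable_RL (left0 u).
have iRLv : mu.-integrable [set: R] (EFin \o (fun x => - derive1 phi x * (pker 1 (b - x) * RL 1 v0 x))).
  apply: integrable_bounded_mul NM _ => //.
  exact: integrable_RL (left0 v).
have bE x (z : R) : derive1 phi x * (pker 1 (b - x) * z) = derive1 phi x * z.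
  by rewrite pker1 subr_gt0; case: ltP => [_|/phi'b ->]; rewrite ?mul1r ?mul0r.
transitivity (\int[mu]_x (- derive1 phi x * (pker 1 (b - x) * RL 1 v0 x) -
   (- G^-1 * derive1 phi x * (pker 1 (b - x) * RL s u0 x)))).
  by apply: eq_Rintegral => x _; ring.
rewrite RintegralB//; apply/eqP; rewrite subr_eq0; apply/eqP.
transitivity (\int[mu]_(x in `]a, b[) (v x * phi x)).
  by rewrite -E2; apply: eq_Rintegral => x _; rewrite !mulNr bE.
by rewrite -E1; apply: eq_Rintegral => x _; rewrite -!mulrA bE.
Qed.

Lemma weak_left_ae : exists c, {ae mu, forall x, a < x < b ->
  RL s u0 x = G * (c + RL 1 v0 x)}.
Proof.
pose h x := pker 1 (b - x) * (G^-1 * RL s u0 x - RL 1 v0 x).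
have ih : mu.-integrable [set: R] (EFin \o h).
  have iRLu := @integrable_RL R s u0 a b s0 iu (left0 u).
  have iRLv := @integrable_RL R 1 v0 a b ltr01 iv (left0 v).
  have := integrableB measurableT (integrableZl measurableT G^-1 iRLu) iRLv.
  apply: eq_integrable => // x _.
  by rewrite /h /= -EFinM -EFinB; congr EFin; ring.
have [c hc] := du_bois_reymond ab ih weak_left_test.
exists c; apply: filterS hc; first exact: (ae_filter_ringOfSetsType mu).
move=> x /= hx axb; have := hx axb; rewrite /h pker1 subr_gt0.
case/andP: (axb) => _ ->; rewrite mul1r => <-.
by rewrite subrK mulVKf// gt_eqF.
Qed.

(** An integral ignores null sets, so applying [RL alpha] to the almost everywhere identity gives
    one valid at every [x <= b]. The constant enters as [c * pker 1 (y - a)], whose image is a beta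
    multiple of (x - a)^alpha. *)
Lemma weak_left_primitive : exists c, forall x, x <= b ->
  fine (pbeta alpha s) * RL 1 u0 x =
  G * (fine (pbeta alpha 1) * (c * pker (alpha + 1) (x - a) + RL (alpha + 1) v0 x)).
Proof.
have [c hc] := weak_left_ae; exists c => x xb.
have as1 : alpha + s = 1 by rewrite /s; lra.
have RLu := @RL_comp R a u0 iu (left0 u) alpha s alpha0 s0.
(* The orders [alpha] and [s] add up to 1, the borderline case of [RL_comp]; this is why exactly the
   primitive of [u0] appears. *)
rewrite as1 in RLu; rewrite -RLu//.
have RLv := @RL_comp R a v0 iv (left0 v) alpha 1 alpha0 ltr01.
have ipk : mu.-integrable [set: R] (fun y => (pker alpha (x - y) * pker 1 (y - a))%:E).
  apply/integrableP; split.
    apply/measurable_EFinP; apply: measurable_funM; apply: measurable_pkerB; exact: measurable_funB.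
  rewrite (_ : (fun y => _) = fun y => `|pker alpha (x - y) * pker 1 (y - a)|%:E)//.
  by rewrite pker_conv_abs -(fineK (pbeta_fin_num alpha0 ltr01)) -EFinM ltry.
have ipv := @integrable_pker_RL R a v0 iv (left0 v) alpha 1 alpha0 ltr01.
have ipu := @integrable_pker_RL R a u0 iu (left0 u) alpha s alpha0 s0.
have a11 : 1 <= alpha + 1 by rewrite lerDr ltW.
have {}RLv := RLv a11; have {}ipv := ipv a11.
have {}ipu := ipu (eq_ind_r (fun z => 1 <= z) (lexx 1) as1).
have icpk : mu.-integrable [set: R] (EFin \o (fun y => c * (pker alpha (x - y) * pker 1 (y - a)))).
  exact: integrableZl ipk.
have isum : mu.-integrable [set: R] (EFin \o (fun y =>
    c * (pker alpha (x - y) * pker 1 (y - a)) + pker alpha (x - y) * RL 1 v0 y)).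
  by have := integrableD measurableT icpk (ipv x); apply: eq_integrable.
have pt (y : R) : (a < y < b -> RL s u0 y = G * (c + RL 1 v0 y)) ->
    pker alpha (x - y) * RL s u0 y = G * (c * (pker alpha (x - y) * pker 1 (y - a)) +
    pker alpha (x - y) * RL 1 v0 y).
  have [ya|ay] := leP y a => hy.
    rewrite (RL0 s (left0 u) ya) (RL0 1 (left0 v) ya).
    by rewrite [pker 1 _]pker_le0 ?subr_le0// !mulr0 addr0 mulr0.
  have [xy|yx] := leP x y.
    by rewrite [pker alpha (x - y)]pker_le0 ?subr_le0// !mul0r mulr0 addr0 mulr0.
  rewrite hy ?(lt_le_trans yx)// [pker 1 (y - a)]pker1 subr_gt0 ay mulr1.
  by rewrite mulrCA (mulrC c) -mulrDr.
transitivity (\int[mu]_y (G * (c * (pker alpha (x - y) * pker 1 (y - a)) +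
    pker alpha (x - y) * RL 1 v0 y))).
  rewrite {1}/RL /Rintegral; congr fine; apply: ae_eq_integral => //.
  - exact: measurable_int (ipu x).
  - apply/measurable_EFinP; apply: measurable_funM => //.
    by apply/measurable_EFinP; exact: measurable_int isum.
  apply: (@filterS _ _ (ae_filter_ringOfSetsType mu) _ _ _ hc) => y hy _.
  by congr EFin; exact: pt.
rewrite RintegralZl_measurable; last first.
  by apply/measurable_EFinP; exact: measurable_int isum.
congr (_ * _); rewrite RintegralD//; last exact: ipv.
rewrite RintegralZl_measurable; last first.
  by apply/measurable_EFinP; exact: measurable_int ipk.
rewrite -[X in _ + X]/(RL alpha (RL 1 v0) x) RLv//.
rewrite [X in c * X](_ : _ = fine (pbeta alpha 1) * pker (alpha + 1) (x - a)).
  by ring.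
by rewrite /Rintegral pker_conv -(fineK (pbeta_fin_num alpha0 ltr01)).
Qed.

End weak_left.
End representation.

(** * Reflection of the line, exchanging left and right derivatives *)

Section reflection.
Context {R : realType}.
Notation mu := (@lebesgue_measure R).
Implicit Types (a b c s r x y z alpha : R) (f g u v phi : R -> R).

Lemma RintegralN_arg f : measurable_fun [set: R] f ->
  \int[mu]_x f (- x) = \int[mu]_x f x.
Proof.
move=> mf; rewrite /Rintegral (@integralN_arg _ (EFin \o f))//.
exact/measurable_EFinP.
Qed.

Lemma integrableN_arg f : mu.-integrable [set: R] (EFin \o f) ->
  mu.-integrable [set: R] (EFin \o (fun x => f (- x))).
Proof.
move=> /integrableP[mf fi]; apply/integrableP; split.
  exact: (measurableT_comp mf).
rewrite (@integralN_arg _ (fun x => `|(f x)%:E|%E))//.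
exact: measurableT_comp.
Qed.

Lemma patch_oppE f a b :
  (fun x => f (- x)) \_ `](- b), (- a)[ = fun x => (f \_ `]a, b[) (- x).
Proof.
rewrite !patch_itvE; apply/funext => x.
by rewrite ltrNl andbC ltrNr.
Qed.

Lemma frac_int_leftE a s f x :
  frac_int_left a s f x =
  (Gamma s)^-1 * \int[mu]_y (pker s (x - y) * (f \_ `]a, +oo[) y).
Proof.
rewrite /frac_int_left; congr (_ * _).
rewrite Rintegral_mkcond; apply: eq_Rintegral => y _; rewrite !patchE.
have [yx|xy] := ltP y x; last first.
  by rewrite pker_le0 ?subr_le0// mul0r memNset//= in_itv/= (ltNge y) xy andbF.
have [ay|ya] := ltP a y; last first.
  by rewrite !memNset/= ?mulr0// in_itv/= ltNge ya.
rewrite !mem_set/= ?in_itv/= ?yx ?ay// pker_gt0 ?subr_gt0// mulrC -powRN.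
by rewrite opprB.
Qed.

Lemma frac_int_left_opp a s phi x : measurable_fun [set: R] phi ->
  frac_int_left a s (fun x => phi (- x)) x = frac_int_right (- a) s phi (- x).
Proof.
move=> mphi; rewrite frac_int_leftE frac_int_rightE; congr (_ * _).
rewrite -[RHS]RintegralN_arg; last first.
  apply: measurable_funM.
    by apply: measurable_pkerB; exact: measurable_funB.
  apply/(measurable_restrictT _ _).1 => //; exact: measurable_funTS.
apply: eq_Rintegral => y _; rewrite opprK addrC; congr (_ * _).
by rewrite !patchE !mem_setE/= !in_itv/= andbT ltrN2.
Qed.

Lemma Cc_infty_opp a b phi : a < b -> Cc_infty `](- b), (- a)[ phi ->
  Cc_infty `]a, b[ (fun x => phi (- x)).
Proof.
move=> ab cphi; have ab' : - b < - a by rewrite ltrN2.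
have [c [d [bc da phi0]]] := Cc_infty_bounds ab' cphi; have [sphi _ _] := cphi.
apply: (@Cc_inftyP _ a b (- d) (- c)); [by rewrite ltrNr|by rewrite ltrNl| |].
  rewrite (_ : (fun x => _) = fun x => phi (- 1 * x + 0)); first exact: smooth_affine.
  by apply/funext => x; rewrite addr0 mulN1r.
by move=> x xdc; apply: phi0; apply: contra xdc => /andP[? ?]; rewrite lerNl lerNr andbC; apply/andP.
Qed.

Lemma derive1_comp_opp f x : derivable f (- x) 1 ->
  derive1 (f \o -%R) x = - derive1 f (- x).
Proof.
move=> df; have Df : is_derive (- x) 1 f (derive1 f (- x)).
  by apply: DeriveDef; rewrite ?derive1E.
have [_ DE] := is_derive1_comp Df (is_deriveNid x (1 : R)).
by rewrite derive1E DE mulrN1.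
Qed.

Lemma frac_der_left_opp a b alpha phi x : a < b -> alpha < 1 ->
  Cc_infty `](- b), (- a)[ phi ->
  frac_der_left a alpha (fun x => phi (- x)) x = frac_der_right (- a) alpha phi (- x).
Proof.
move=> ab a1 cphi; have ab' : - b < - a by rewrite ltrN2.
have s0 : 0 < 1 - alpha by rewrite subr_gt0.
have mphi : measurable_fun [set: R] phi.
  by apply: continuous_measurable_fun; apply: smooth_continuous; case: cphi.
rewrite /frac_der_left /frac_der_right.
rewrite (_ : frac_int_left _ _ _ = frac_int_right (- a) (1 - alpha) phi \o -%R); last first.
  by apply/funext => y /=; exact: frac_int_left_opp.
have [D _] := is_derive_frac_int_right (- x) ab' s0 cphi.
exact: derive1_comp_opp.
Qed.

(** Measurability is what reflecting an integral calls for. The Caputo form is an integral operator,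
    and cutting its kernel off at [x > a] bounds the columns. *)
Lemma measurable_frac_der_right a b alpha phi : a < b -> alpha < 1 ->
  Cc_infty `]a, b[ phi -> measurable_fun `]a, b[ (frac_der_right b alpha phi).
Proof.
move=> ab a1 cphi; have [sphi _ _] := cphi.
have s0 : 0 < 1 - alpha by rewrite subr_gt0.
set s := 1 - alpha in s0 *.
have [c [d [ac db phi0]]] := Cc_infty_bounds ab cphi.
have phi'0 := derive1_support phi0.
have cphi' := smooth_continuous (smooth_derive1 sphi).
have iphi' := integrable_of_support cphi' phi'0.
pose K x y := pker s (y - x) * pker 1 (x - a).
have mK : measurable_fun [set: R * R] (fun w => K w.1 w.2).
  apply: measurable_funM; apply: (measurableT_comp (measurable_pker _)).
    by apply: measurable_funB; [exact: measurable_snd|exact: measurable_fst].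
  by apply: measurable_funB => //; exact: measurable_fst.
have M0 : 0 <= fine (pbeta s 1) * pker (s + 1) (b - a).
  by rewrite mulr_ge0 ?pker_ge0 ?fine_ge0 ?pbeta_ge0.
have KM y : derive1 phi y != 0 -> (\int[mu]_x `|K x y|%:E <=
    (fine (pbeta s 1) * pker (s + 1) (b - a))%:E)%E.
  move=> py; rewrite /K pker_conv_abs -(fineK (pbeta_fin_num s0 ltr01)) -EFinM lee_fin.
  rewrite ler_wpM2l ?fine_ge0 ?pbeta_ge0// pker_monotone//; first by rewrite lerDr ltW.
  rewrite lerB// leNgt; apply/negP => yb; move: py; rewrite phi'0 ?eqxx//.
  by rewrite negb_and -!ltNge (lt_trans db yb) orbT.
have mT := measurable_kernel_op mK M0 iphi' KM.
have mT' : measurable_fun `]a, b[ (fun x => - (Gamma s)^-1 * \int[mu]_y (K x y * derive1 phi y)).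
  by apply: measurable_funTS; exact: measurable_funM.
apply: eq_measurable_fun mT' => x; rewrite inE/= in_itv/= => /andP[ax xb].
rewrite (frac_der_rightE _ ab a1 cphi) -/s; congr (_ * _); apply: eq_Rintegral => y _.
by rewrite /K pker1 subr_gt0 ax mulr1.
Qed.

Lemma locally_integrable_patch a b v : locally_integrable `]a, b[ v ->
  measurable_fun [set: R] (v \_ `]a, b[).
Proof. by case=> mv _ _; apply/(measurable_restrictT _ _).1. Qed.

Lemma Lp1_integrable (D : set R) u : Lp D 1%E u <-> mu.-integrable [set: R] (EFin \o (u \_ D)).
Proof. exact: Lfun1_integrable. Qed.

Lemma locally_integrable_opp a b v : locally_integrable `]a, b[ v ->
  locally_integrable `](- b), (- a)[ (fun x => v (- x)).
Proof.
move=> lv; have mv0 := locally_integrable_patch lv; case: lv => mv _ vK; split.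
- apply/(measurable_restrictT _ _).2 => //; rewrite patch_oppE.
  exact: measurableT_comp.
- exact: itv_open.
move=> K KD cK.
pose K' := -%R @` K.
have cK' : compact K'.
  apply: continuous_compact => //; apply: continuous_subspaceT => x; exact: oppr_continuous.
have K'D : K' `<=` `]a, b[.
  by move=> _ [x Kx <-]; move: (KD _ Kx); rewrite /= !in_itv/= ltrNr ltrNl andbC.
have K'E x : (x \in K') = (- x \in K).
  apply/idP/idP; rewrite !inE; first by case=> y Ky <-; rewrite opprK.
  by move=> Kx; exists (- x); rewrite ?opprK.
have := vK K' K'D cK'; apply: le_lt_trans.
rewrite integral_mkcond [in leRHS]integral_mkcond.
rewrite -[leRHS]integralN_arg.
  rewrite le_eqVlt; apply/orP; left; apply/eqP; apply: eq_integral => x _.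
  by rewrite !patchE K'E opprK.
apply/(measurable_restrictT _ _).1; first exact: compact_measurable.
apply/measurable_EFinP; apply: measurableT_comp => //.
apply: measurable_funS mv => //.
Qed.

Lemma weak_right_opp a b alpha u v : a < b -> 0 < alpha -> alpha < 1 ->
  weak_frac_der_right a b alpha u v ->
  weak_frac_der_left (- b) (- a) alpha (fun x => u (- x)) (fun x => v (- x)).
Proof.
move=> ab a0 a1 [/Lp1_integrable Lu lv uv]; split.
- apply/Lp1_integrable; rewrite patch_oppE; exact: integrableN_arg.
- exact: locally_integrable_opp.
move=> phi cphi; have cphi' := Cc_infty_opp ab cphi.
have mphi : measurable_fun [set: R] phi.
  by apply: continuous_measurable_fun; apply: smooth_continuous; case: cphi.
have ab' : - b < - a by rewrite ltrN2.
have mD := measurable_frac_der_right ab' a1 cphi.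
have mv0 := locally_integrable_patch lv.
have mu0 : measurable_fun [set: R] (u \_ `]a, b[).
  by apply/measurable_EFinP; exact: measurable_int Lu.
have refl (w g : R -> R) : measurable_fun [set: R] (w \_ `]a, b[) ->
    measurable_fun `](- b), (- a)[ g ->
    \int[mu]_(x in `](- b), (- a)[) (w (- x) * g x) =
    \int[mu]_(x in `]a, b[) (w x * g (- x)).
  move=> mw mg.
  have mg0 : measurable_fun [set: R] (g \_ `](- b), (- a)[) by apply/(measurable_restrictT _ _).1.
  rewrite Rintegral_mkcond [RHS]Rintegral_mkcond.
  rewrite [LHS](_ : _ = \int[mu]_x ((w \_ `]a, b[) (- x) * (g \_ `](- b), (- a)[) (- - x))).
    rewrite (@RintegralN_arg (fun x => (w \_ `]a, b[) x * (g \_ `](- b), (- a)[) (- x))).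
      apply: eq_Rintegral => x _; rewrite !patch_itvE !ltrN2 [X in _ * (if X then _ else _)]andbC.
      by case: ifP => _; rewrite ?mulr0.
    by apply: measurable_funM => //; exact: measurableT_comp.
  apply: eq_Rintegral => x _; rewrite !patch_itvE opprK ltrNr ltrNl andbC.
  by case: ifP => _; rewrite ?mulr0.
rewrite refl//; last exact: measurable_funTS.
rewrite refl//.
rewrite (uv _ cphi').
by apply: eq_Rintegral => x _; rewrite (frac_der_left_opp _ ab a1 cphi).
Qed.

End reflection.

(** * Vanishing of the boundary constant *)

Section vanishing_constant.
Context {R : realType}.
Notation mu := (@lebesgue_measure R).
Implicit Types (a b c s r x y z t h alpha : R) (f g u v phi : R -> R).

Lemma cvg_Rintegral0 (k : nat -> R -> R) f :
  mu.-integrable [set: R] (EFin \o f) ->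
  (forall n, measurable_fun [set: R] (k n)) ->
  (forall n y, f y != 0 -> `|k n y| <= 1) ->
  (forall y, f y != 0 -> k n y @[n --> \oo] --> 0) ->
  \int[mu]_y (k n y * f y) @[n --> \oo] --> 0.
Proof.
move=> if_ mk k1 k0.
have mf : measurable_fun [set: R] f.
  by apply/measurable_EFinP; exact: measurable_int if_.
have mF n : measurable_fun [set: R] (fun x => (k n x * f x)%:E).
  by apply/measurable_EFinP; exact: measurable_funM.
have [|||_ _] := @dominated_convergence _ _ _ mu [set: R] measurableT
  (fun n x => (k n x * f x)%:E) (cst 0%E) (fun x => `|(f x)%:E|%E) mF (measurable_cst _).
- apply: aeW => x _; have [fx0|fx0] := eqVneq (f x) 0.
    under eq_fun do rewrite fx0 mulr0.
    exact: cvg_cst.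
  apply: cvg_EFin; first exact: nearW.
  by rewrite -(mul0r (f x)); apply: cvgMl; exact: k0.
- exact: integrable_abse.
- apply: aeW => x n _; have [fx0|fx0] := eqVneq (f x) 0.
    by rewrite /= fx0 mulr0 normr0.
  by rewrite EFinM abseM -[leRHS]mul1e lee_wpmul2r// lee_fin k1.
rewrite integral0 => h0; exact: fine_cvg.
Qed.

Section power_increment.
Variable alpha : R.
Hypotheses (alpha0 : 0 < alpha) (alpha1 : alpha < 1).

(** A Hoelder quotient: the increment of t_+^alpha over [t - h, t] divided by h^alpha. It lies
    between 0 and 1 and, for fixed t, tends to 0 with h. *)
Definition pincr t h := (pker (alpha + 1) t - pker (alpha + 1) (t - h)) / h `^ alpha.

Lemma pkerS t : 0 < t -> pker (alpha + 1) t = t `^ alpha.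
Proof. by move=> t0; rewrite pker_gt0// addrK. Qed.

Lemma pincr_ge0 t h : 0 < h -> 0 <= pincr t h.
Proof.
move=> h0; rewrite divr_ge0 ?powR_ge0// subr_ge0 pker_monotone//; last lra.
by rewrite lerDr ltW.
Qed.

(* From 1 - q <= (1 - q) `^ alpha with q = h / t. *)
Lemma pincr_le_ratio t h : 0 < h -> h < t -> pincr t h <= (h / t) `^ (1 - alpha).
Proof.
move=> h0 ht; have t0 : 0 < t by exact: lt_trans ht.
rewrite /pincr !pkerS ?subr_gt0// ler_pdivrMr ?powR_gt0//.
have -> : (h / t) `^ (1 - alpha) * h `^ alpha = t `^ alpha * (h / t).
  rewrite powRM ?ltW ?invr_gt0// mulrAC -powRD ?subrK; last by rewrite gt_eqF ?implybT.
  rewrite (powRr1 (ltW h0)) -powR_inv1 ?(ltW t0)// -powRrM mulN1r opprB.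
  rewrite [RHS]mulrCA -powRD; last by rewrite (gt_eqF t0) implybT.
  by [].
have th0 : 0 < t - h by rewrite subr_gt0.
rewrite lerBlDr -lerBlDl -{1}(mulr1 (t `^ alpha)) -mulrBr.
rewrite (_ : t - h = t * (1 - h / t)); last by field; rewrite gt_eqF.
have q1 : h / t < 1 by rewrite ltr_pdivrMr ?mul1r.
have q0 : 0 < h / t by rewrite divr_gt0.
rewrite powRM ?(ltW t0) ?subr_ge0 ?(ltW q1)// ler_wpM2l ?powR_ge0//.
apply: ger1_powR; last exact: ltW.
by rewrite subr_gt0 q1 gerBl ltW.
Qed.

Lemma pincr_le1 t h : 0 < h -> pincr t h <= 1.
Proof.
move=> h0; have [t0|t0] := leP t 0.
  by rewrite /pincr !pker_le0 ?subrr ?mul0r//; lra.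
have [th|ht] := leP t h.
  rewrite /pincr [X in _ - X]pker_le0 ?subr_le0// subr0 pkerS//.
  rewrite ler_pdivrMr ?powR_gt0// mul1r.
  by apply: ge0_ler_powR; rewrite ?nnegrE//; exact: ltW.
apply: le_trans (pincr_le_ratio h0 ht) _.
apply: (@le_trans _ _ (1 `^ (1 - alpha))); last by rewrite powR1.
rewrite ge0_ler_powR ?nnegrE//.
- by rewrite subr_ge0 ltW.
- by rewrite divr_ge0// ltW.
- by rewrite ler_pdivrMr// mul1r ltW.
Qed.

Lemma pincr_norm_le1 t h : 0 < h -> `|pincr t h| <= 1.
Proof. by move=> h0; rewrite ger0_norm ?pincr_ge0 ?pincr_le1. Qed.

Lemma cvg_pincr t (h_ : R^nat) : (forall n, 0 < h_ n) -> h_ n @[n --> \oo] --> 0 ->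
  pincr t (h_ n) @[n --> \oo] --> 0.
Proof.
move=> h0 hcvg; have [t0|t0] := leP t 0.
  rewrite (_ : (fun n => _) = fun=> 0); first exact: cvg_cst.
  by apply/funext => n; rewrite /pincr !pker_le0 ?subrr ?mul0r//; have := h0 n; lra.
have s0 : 0 < 1 - alpha by rewrite subr_gt0.
apply/cvgr0Pnorm_le => e e0.
(* The minimum with 1 keeps [h_ n < t]; the other term makes the ratio bound at most [e]. *)
pose d := Num.min 1 (e `^ (1 - alpha)^-1) * t.
have d0 : 0 < d by rewrite mulr_gt0// lt_min ltr01 powR_gt0.
move/cvgr0Pnorm_lt : hcvg => /(_ _ d0); apply: filterS => n.
have hn0 := h0 n; rewrite gtr0_norm// /d => hd.
have ht : h_ n < t.
  apply: lt_le_trans hd _; rewrite ler_piMl ?(ltW t0)//.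
rewrite ger0_norm ?pincr_ge0//; apply: le_trans (pincr_le_ratio hn0 ht) _.
have -> : e = (e `^ (1 - alpha)^-1) `^ (1 - alpha).
  by rewrite -powRrM mulVf ?powRr1 ?ltW// gt_eqF.
rewrite ge0_ler_powR ?nnegrE ?powR_ge0 ?(ltW s0) ?divr_ge0 ?(ltW hn0) ?(ltW t0)//.
rewrite ler_pdivrMr//; apply: le_trans (ltW hd) _.
by rewrite ler_wpM2r ?(ltW t0)// ge_min lexx orbT.
Qed.

End power_increment.

Lemma RL1E f x : RL 1 f x = \int[mu]_(y in `]-oo, x[) f y.
Proof.
rewrite [RHS]Rintegral_mkcond; apply: eq_Rintegral => y _.
rewrite pker1 subr_gt0 patchE mem_setE/= in_itv/=.
by case: (y < x); rewrite ?mul1r ?mul0r.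
Qed.

Lemma RL1_closedE f x : mu.-integrable [set: R] (EFin \o f) ->
  RL 1 f x = \int[mu]_(y in `]-oo, x]) f y.
Proof. by move=> if_; rewrite RL1E Rintegral_itv_bndo_bndc//; exact: integrableS if_. Qed.

Lemma integrable_pker_mul s f a x : 1 <= s ->
  mu.-integrable [set: R] (EFin \o f) -> (forall y, y <= a -> f y = 0) ->
  mu.-integrable [set: R] (EFin \o (fun y => pker s (x - y) * f y)).
Proof.
move=> s1 if_ f0.
have iM := integrableZl measurableT (pker s (x - a)) if_.
apply: le_integrable iM => //.
  apply/measurable_EFinP; apply: measurable_funM.
    by apply: measurable_pkerB; exact: measurable_funB.
  by apply/measurable_EFinP; exact: measurable_int if_.
move=> y _; rewrite /comp -EFinM /= lee_fin !normrM !(ger0_norm (pker_ge0 _ _)).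
have [ya|ay] := leP y a; first by rewrite f0// normr0 !mulr0.
by rewrite ler_wpM2r// pker_monotone//; lra.
Qed.

(** The integral of [u] next to [a] is a difference of two primitives of the reflected function,
    which start at [- b]; this lets the right derivative act near [a]. *)
Lemma RL1_reflect u a b h : mu.-integrable [set: R] (EFin \o (u \_ `]a, b[)) ->
  0 < h ->
  let u0 := (u \_ `]a, b[) in
  let ur := ((fun x => u (- x)) \_ `](- b), (- a)[) in
  RL 1 u0 (a + h) = RL 1 ur (- a) - RL 1 ur (- a - h).
Proof.
move=> iu h0 u0 ur.
have mu0 : measurable_fun [set: R] u0.
  by apply/measurable_EFinP; exact: measurable_int iu.
have iur : mu.-integrable [set: R] (EFin \o ur).
  by rewrite /ur patch_oppE; exact: integrableN_arg.
have ur0 y : y <= - b -> ur y = 0.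
  by move=> yb; rewrite /ur patch_itvE ltNge yb.
have yE (z : R) : (- z <= a + h) = ~~ (z < - a - h).
  by rewrite -leNgt -subr_ge0 -[RHS]subr_ge0; congr (_ <= _); ring.
(* With the interval closed, [- y <= a + h] is exactly the negation of [y < - a - h], and the
   integrands agree at every point. *)
rewrite RL1_closedE// [in LHS]Rintegral_mkcond -RintegralN_arg; last first.
  by apply/(measurable_restrictT _ _).1 => //; exact: measurable_funTS.
rewrite /RL -RintegralB//; [|exact: integrable_pker_mul ur0|exact: integrable_pker_mul ur0].
apply: eq_Rintegral => y _; rewrite !patchE !pker1 !subr_gt0.
rewrite mem_setE/= in_itv/= -/(ur y).
have -> : ur y = u0 (- y) by rewrite /ur patch_oppE.
have [ya|ay] := ltP y (- a); last first.
  have -> : u0 (- y) = 0 by rewrite /u0 patch_itvE ifF//; apply/negbTE; rewrite negb_and -leNgt lerNl ay.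
  by rewrite !mulr0 subr0; case: ifP.
rewrite yE.
by case: (y < _); rewrite ?mul1r ?mul0r ?subrr ?subr0.
Qed.

(** Pure algebra. [X], [Y], [Z] are the primitive of [u] at a + h and those of the reflected [u] at
    - a and - a - h; [H] is h^alpha, [p] and [q] are the powers multiplying [c'], and [V], [W1],
    [W2] the integrals of order alpha + 1. *)
Lemma eliminate_primitives (B G b1 c c' H X Y Z V W1 W2 p q : R) :
  G != 0 -> b1 != 0 -> H != 0 ->
  B * X = G * (b1 * (c * H + V)) -> B * Y = G * (b1 * (c' * p + W1)) ->
  B * Z = G * (b1 * (c' * q + W2)) -> X = Y - Z ->
  c = c' * ((p - q) / H) + (W1 - W2) / H - V / H.
Proof.
move=> G0 b0 H0 eX eY eZ XYZ; move: eX; rewrite XYZ mulrBr eY eZ -!mulrBr.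
move=> /(mulfI G0) /(mulfI b0) e.
by apply: (mulIf H0); rewrite -(addrK V (c * H)) -e; field.
Qed.

Lemma weak_left_right_primitive a b alpha u v w : a < b -> 0 < alpha -> alpha < 1 ->
  weak_frac_der_left a b alpha u v ->
  weak_frac_der_left (- b) (- a) alpha (fun x => u (- x)) (fun x => w (- x)) ->
  mu.-integrable [set: R] (EFin \o (v \_ `]a, b[)) ->
  mu.-integrable [set: R] (EFin \o (w \_ `]a, b[)) ->
  forall x, x <= b ->
  fine (pbeta alpha (1 - alpha)) * RL 1 (u \_ `]a, b[) x =
  Gamma (1 - alpha) * (fine (pbeta alpha 1) * RL (alpha + 1) (v \_ `]a, b[) x).
Proof.
move=> ab alpha0 alpha1 uv uw iv iw.
have iu : mu.-integrable [set: R] (EFin \o (u \_ `]a, b[)).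
  by apply/Lp1_integrable; case: uv.
have [c hc] := weak_left_primitive ab alpha0 alpha1 uv iu iv.
have ab' : - b < - a by rewrite ltrN2.
have iur : mu.-integrable [set: R] (EFin \o ((fun x => u (- x)) \_ `](- b), (- a)[)).
  by rewrite patch_oppE; exact: integrableN_arg.
have iwr : mu.-integrable [set: R] (EFin \o ((fun x => w (- x)) \_ `](- b), (- a)[)).
  by rewrite patch_oppE; exact: integrableN_arg.
have [c' hc'] := weak_left_primitive ab' alpha0 alpha1 uw iur iwr.
set u0 := u \_ _ in iu hc *; set v0 := v \_ _ in iv hc *.
set ur := _ \_ _ in iur hc'; set wr := _ \_ _ in iwr hc'.
set G := Gamma (1 - alpha) in hc hc' *.
have G0 : 0 < G by apply: Gamma_gt0; rewrite ?subr_gt0 ?gerBl ?ltW.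
have b10 : 0 < fine (pbeta alpha 1).
  by rewrite fine_gt0// pbeta_gt0 ?(ltW alpha1)//= pbeta_lty.
(* The right representation of u gives \int_a^(a+h) u = o(h `^ alpha), whereas
   the left one gives this integral as a nonzero multiple of c * h `^ alpha, up
   to o(h `^ alpha). *)
suff c0 : c = 0 by move=> x xb; rewrite hc// c0 mul0r add0r.
(* The numerator [b - a] keeps [a + h_ n] in the range [x <= b] of the left representation. *)
pose h_ n : R := (b - a) / n.+1%:R.
have h0 n : 0 < h_ n by rewrite divr_gt0 ?subr_gt0.
have hb n : h_ n <= b - a.
  by rewrite ler_pdivrMr// ler_peMr ?subr_ge0 ?(ltW ab)// ler1n.
have hcvg : h_ n @[n --> \oo] --> 0.
  rewrite -(mulr0 (b - a)); apply: cvgMr; exact: cvg_harmonic.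
(* Where [v0 y != 0] one has [y > a]: the power of a + h - y is then at most h^alpha, and it
   vanishes as soon as h < y - a. *)
have T1 : \int[mu]_y (pker (alpha + 1) (a + h_ n - y) / h_ n `^ alpha * v0 y) @[n --> \oo] --> 0.
  apply: cvg_Rintegral0 => //.
  - move=> n; apply: measurable_funM => //; apply: measurable_pkerB.
    exact: measurable_funB.
  - move=> n y vy.
    have ay : a < y.
      by rewrite ltNge; apply: contra vy => ya; rewrite /v0 patch_itvE ltNge ya.
    rewrite ger0_norm ?divr_ge0 ?pker_ge0 ?powR_ge0//.
    rewrite ler_pdivrMr ?powR_gt0// mul1r -pkerS// pker_monotone//; last lra.
    by rewrite lerDr ltW.
  - move=> y vy.
    have ay : a < y.
      by rewrite ltNge; apply: contra vy => ya; rewrite /v0 patch_itvE ltNge ya.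
    have ya0 : 0 < y - a by rewrite subr_gt0.
    apply: (@cvg_trans _ ((fun=> 0) @ \oo)); last exact: cvg_cst.
    apply: near_eq_cvg.
    move/cvgr0Pnorm_lt : hcvg => /(_ _ ya0); apply: filterS => n.
    by rewrite gtr0_norm// => hy; rewrite pker_le0 ?mul0r//; lra.
have T2 : \int[mu]_y (pincr alpha (- a - y) (h_ n) * wr y) @[n --> \oo] --> 0.
  apply: cvg_Rintegral0 => //.
  - move=> n; apply: measurable_funM => //.
    by apply: measurable_funB; apply: measurable_pkerB; [|apply: measurable_funB => //]; exact: measurable_funB.
  - by move=> n y _; exact: pincr_norm_le1.
  - by move=> y _; exact: cvg_pincr.
have a11 : 1 <= alpha + 1 by rewrite lerDr ltW.
have ipv x : mu.-integrable [set: R] (EFin \o (fun y => pker (alpha + 1) (x - y) * v0 y)).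
  by apply: (integrable_pker_mul (a := a) _ a11 iv) => y ya; rewrite /v0 patch_itvE ltNge ya.
have ipw x : mu.-integrable [set: R] (EFin \o (fun y => pker (alpha + 1) (x - y) * wr y)).
  by apply: (integrable_pker_mul (a := - b) _ a11 iwr) => y ya; rewrite /wr patch_itvE ltNge ya.
(* [c'] remains unknown, but its factor is the increment of the power at distance [b - a] from its
   singularity, negligible against h^alpha. *)
have T3 := cvg_pincr alpha0 alpha1 (b - a) h0 hcvg.
have E n : c = c' * pincr alpha (b - a) (h_ n) +
    \int[mu]_y (pincr alpha (- a - y) (h_ n) * wr y) -
    \int[mu]_y (pker (alpha + 1) (a + h_ n - y) / h_ n `^ alpha * v0 y).
  have hn0 : 0 < h_ n `^ alpha by rewrite powR_gt0.
  have -> : \int[mu]_y (pker (alpha + 1) (a + h_ n - y) / h_ n `^ alpha * v0 y) =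
      RL (alpha + 1) v0 (a + h_ n) / h_ n `^ alpha.
    rewrite /RL -(RintegralZr _ measurableT (ipv _)).
    by apply: eq_Rintegral => y _; rewrite mulrAC.
  have -> : \int[mu]_y (pincr alpha (- a - y) (h_ n) * wr y) =
      (RL (alpha + 1) wr (- a) - RL (alpha + 1) wr (- a - h_ n)) / h_ n `^ alpha.
    rewrite /RL -(RintegralB measurableT (ipw _) (ipw _)).
    have ipB : mu.-integrable [set: R] (EFin \o (fun y => pker (alpha + 1) (- a - y) * wr y -
        pker (alpha + 1) (- a - h_ n - y) * wr y)).
      by have := integrableB measurableT (ipw (- a)) (ipw (- a - h_ n)); apply: eq_integrable.
    rewrite -(RintegralZr _ measurableT ipB).
    apply: eq_Rintegral => y _; rewrite /pincr -[in RHS]mulrBl mulrAC.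
    by congr (_ * _); congr (_ * _); congr (_ - pker _ _); ring.
  have ahb : a + h_ n <= b by rewrite -lerBrDl.
  have ahn : - a - h_ n <= - a by rewrite gerBl ltW.
  have e1 := hc _ ahb; have e2 := hc' _ (lexx _); have e3 := hc' _ ahn.
  have e4 := RL1_reflect iu (h0 n).
  rewrite (_ : a + h_ n - a = h_ n) in e1; last by ring.
  rewrite (_ : - a - - b = b - a) in e2; last by ring.
  rewrite (_ : - a - h_ n - - b = b - a - h_ n) in e3; last by ring.
  rewrite (pkerS alpha (h0 n)) in e1.
  exact: (eliminate_primitives (lt0r_neq0 G0) (lt0r_neq0 b10) (lt0r_neq0 hn0) e1 e2 e3 e4).
have lim0 : c' * pincr alpha (b - a) (h_ n) +
    \int[mu]_y (pincr alpha (- a - y) (h_ n) * wr y) -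
    \int[mu]_y (pker (alpha + 1) (a + h_ n - y) / h_ n `^ alpha * v0 y) @[n --> \oo] --> 0.
  rewrite [X in _ --> X](_ : _ = c' * 0 + 0 - 0); last by rewrite mulr0 addr0 subr0.
  by apply: cvgB => //; apply: cvgD => //; exact: cvgMr.
have : (fun=> c) n @[n --> \oo] --> 0.
  by apply: cvg_trans lim0; apply: near_eq_cvg; apply: nearW => n; rewrite -E.
by move/(cvg_lim (@Rhausdorff R)) <-; rewrite lim_cst.
Qed.

End vanishing_constant.

(** * The L^p bound for Riemann-Liouville integrals *)

Section young.
Context {R : realType}.
Notation mu := (@lebesgue_measure R).
Implicit Types (a b c s r x y z t h alpha p : R) (f g u v k : R -> R).

Lemma measurable_powR_comp p f : measurable_fun [set: R] f ->
  measurable_fun [set: R] (fun x => f x `^ p).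
Proof. by move=> mf; exact: (measurableT_comp (measurable_powR p) mf). Qed.

(* Hoelder applied to k * |f| = k `^ q^-1 * (k `^ p^-1 * |f|). *)
Lemma hoelder_weight p (A : R) k f : 1 < p ->
  measurable_fun [set: R] k -> measurable_fun [set: R] f -> (forall y, 0 <= k y) ->
  (\int[mu]_y (k y)%:E <= A%:E)%E ->
  ((\int[mu]_y `|k y * f y|%:E) `^ p <=
   (A `^ (p - 1))%:E * \int[mu]_y (k y * `|f y| `^ p)%:E)%E.
Proof.
move=> p1 mk mf k0 kA.
have p0 : 0 < p by apply: lt_trans p1.
have pm1 : 0 < p - 1 by rewrite subr_gt0.
pose q := p / (p - 1).
have q0 : 0 < q by rewrite divr_gt0.
have pN0 := lt0r_neq0 p0; have pmN0 := lt0r_neq0 pm1; have qN0 := lt0r_neq0 q0.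
have qV : q^-1 = (p - 1) / p by rewrite /q invf_div.
have pq : p^-1 + q^-1 = 1 by rewrite qV; field.
pose F y := k y `^ p^-1 * `|f y|.
pose G y := k y `^ q^-1.
have mG : measurable_fun [set: R] G by exact: measurable_powR_comp.
have mF : measurable_fun [set: R] F.
  by apply: measurable_funM; [exact: measurable_powR_comp|exact: measurableT_comp].
have FG y : F y * G y = k y * `|f y|.
  rewrite /F /G mulrAC -powRD ?pq ?powRr1//.
  by rewrite oner_eq0.
have A0 : 0 <= A by rewrite -lee_fin; apply: le_trans kA; apply: integral_ge0 => y _; rewrite lee_fin.
have H := hoelder mu mF mG p0 q0 pq.
have N1 : ('N[mu]_1[(EFin \o (F \* G)%R)] = \int[mu]_y `|k y * f y|%:E)%E.
  rewrite Lnorm1; apply: eq_integral => y _ /=.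
  by rewrite FG !normrM normr_id.
have Nq : ('N[mu]_q%:E[(EFin \o G)] <= (A `^ q^-1)%:E)%E.
  rewrite unlock -poweR_EFin; apply: gt0_ler_poweR.
  - by rewrite invr_ge0 ltW.
  - by rewrite in_itv/= leey andbT integral_ge0// => y _; exact: poweR_ge0.
  - by rewrite in_itv/= leey andbT lee_fin.
  apply: le_trans kA; rewrite le_eqVlt; apply/orP; left; apply/eqP.
  apply: eq_integral => y _ /=; rewrite ger0_norm ?powR_ge0//.
  by rewrite /G -powRrM mulVf// powRr1.
have Np : ('N[mu]_p%:E[(EFin \o F)] `^ p = \int[mu]_y (k y * `|f y| `^ p)%:E)%E.
  rewrite poweR_Lnorm//; apply: eq_integral => y _ /=.
  rewrite ger0_norm ?mulr_ge0 ?powR_ge0// /F powRM ?powR_ge0//.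
  by rewrite -powRrM mulVf// powRr1.
rewrite N1 in H.
have {}H := le_trans H (lee_wpmul2l (Lnorm_ge0 _ _ _) Nq).
have Hp := @gt0_ler_poweR R p (ltW p0) _ _ _ _ H.
apply: le_trans (Hp _ _) _.
- by rewrite in_itv/= leey integral_ge0.
- by rewrite in_itv/= leey mule_ge0// ?Lnorm_ge0// lee_fin powR_ge0.
rewrite poweRM ?Lnorm_ge0 ?lee_fin ?powR_ge0// Np muleC.
rewrite poweR_EFin -powRrM qV divfK//.
Qed.

(** A common bound for the row and column integrals of the kernel on an interval of length [L]: each
    is a beta value times at most L^alpha, and the sum dominates both. For alpha > 0 both beta
    values are 1/alpha. *)
Definition young_const alpha (L : R) : R :=
  (fine (pbeta 1 alpha) + fine (pbeta alpha 1)) * L `^ alpha.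

Section riemann_liouville_Lp.
Variables (a b alpha p : R) (v0 : R -> R).
Hypotheses (ab : a < b) (alpha0 : 0 < alpha) (p1 : 1 < p).
Hypothesis iv : mu.-integrable [set: R] (EFin \o v0).
Hypothesis v0a : forall y, y <= a -> v0 y = 0.
Let A := young_const alpha (b - a).

Let mv : measurable_fun [set: R] v0.
Proof. by apply/measurable_EFinP; exact: measurable_int iv. Qed.

Let A1 x : x <= b -> (\int[mu]_y (pker alpha (x - y) * pker 1 (y - a))%:E <= A%:E)%E.
Proof.
move=> xb; rewrite pker_conv -(fineK (pbeta_fin_num alpha0 ltr01)) -EFinM lee_fin.
rewrite /A /young_const ler_pM ?fine_ge0 ?pbeta_ge0 ?pker_ge0//.
  by rewrite lerDr fine_ge0 ?pbeta_ge0.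
rewrite -pkerS ?subr_gt0// pker_monotone//; last by rewrite lerB.
by rewrite lerDr ltW.
Qed.

Let A2 y : a <= y -> (\int[mu]_x (pker 1 (b - x) * pker alpha (x - y))%:E <= A%:E)%E.
Proof.
move=> ay; rewrite pker_conv -(fineK (pbeta_fin_num ltr01 alpha0)) -EFinM lee_fin.
rewrite /A /young_const ler_pM ?fine_ge0 ?pbeta_ge0 ?pker_ge0//.
  by rewrite lerDl fine_ge0 ?pbeta_ge0.
rewrite -pkerS ?subr_gt0// (addrC 1) pker_monotone//; last by rewrite lerB.
by rewrite lerDr ltW.
Qed.

(** The Hoelder weight is the kernel cut off at [a], below which [v0] vanishes; without the cut-off
    its integral would diverge. *)
Lemma RL_pointwise x : x <= b ->
  ((`|RL alpha v0 x| `^ p)%:E <=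
   (A `^ (p - 1))%:E * \int[mu]_y (pker alpha (x - y) * `|v0 y| `^ p)%:E)%E.
Proof.
move=> xb.
have mk s : measurable_fun [set: R] (fun y => pker s (x - y)).
  by apply: measurable_pkerB; exact: measurable_funB.
have mk1 : measurable_fun [set: R] (fun y => pker 1 (y - a)).
  by apply: measurable_pkerB; exact: measurable_funB.
have := hoelder_weight p1 (measurable_funM (mk alpha) mk1) mv _ (A1 xb).
move=> /(_ (fun y => mulr_ge0 (pker_ge0 _ _) (pker_ge0 _ _))) H.
have v1 y (e : R -> R) : e 0 = 0 -> pker 1 (y - a) * e (v0 y) = e (v0 y).
  move=> e0; rewrite pker1 subr_gt0; case: ltP => [_|/v0a ->]; first by rewrite mul1r.
  by rewrite e0 mulr0.
rewrite [X in (_ <= _ * X)%E](_ : _ = \int[mu]_y (pker alpha (x - y) * `|v0 y| `^ p)%:E)%E in H; last first.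
  apply: eq_integral => y _; rewrite -mulrA; congr ((_ * _)%:E).
  apply: (v1 y (fun t => `|t| `^ p)); rewrite normr0 powR0// gt_eqF//.
  exact: lt_trans p1.
apply: le_trans H.
rewrite -poweR_EFin; apply: gt0_ler_poweR.
- by apply: ltW; exact: lt_trans p1.
- by rewrite in_itv/= lee_fin normr_ge0 leey.
- by rewrite in_itv/= leey integral_ge0.
under eq_integral do rewrite -mulrA (v1 _ id erefl).
have mE : measurable_fun [set: R] (fun y => (pker alpha (x - y) * v0 y)%:E).
  by apply/measurable_EFinP; exact: measurable_funM.
apply: le_trans (le_abse_integral mu measurableT mE).
rewrite /RL /Rintegral; case: (integral _ _ _) => [r| |] //=; rewrite normr0 ?lee_fin ?leey//.
Qed.

(** A Schur test: the row bound gives A^(p - 1) through the weighted Hoelder inequality, and the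
    column bound gives [A] after Tonelli. Their product A^p makes the norm bound independent of
    p. *)
Lemma young :
  (\int[mu]_x ((pker 1 (b - x) * `|RL alpha v0 x|) `^ p)%:E <=
   (A `^ p)%:E * \int[mu]_y (`|v0 y| `^ p)%:E)%E.
Proof.
have p0 : 0 < p by apply: lt_trans p1.
have A0 : 0 <= A.
  by rewrite mulr_ge0 ?powR_ge0// addr_ge0 ?fine_ge0 ?pbeta_ge0.
have mvp : measurable_fun [set: R] (fun y => `|v0 y| `^ p).
  by apply: measurable_powR_comp; exact: measurableT_comp.
pose F (w : measurableTypeR R * measurableTypeR R) : \bar R :=
  (pker 1 (b - w.1) * pker alpha (w.1 - w.2) * `|v0 w.2| `^ p)%:E.
have F0 w : (0 <= F w)%E by rewrite lee_fin !mulr_ge0 ?pker_ge0 ?powR_ge0.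
have mF : measurable_fun [set: measurableTypeR R * measurableTypeR R] F.
  apply/measurable_EFinP; apply: measurable_funM.
    exact: measurable_conv_kernel.
  exact: measurableT_comp mvp (measurable_snd).
have FE x : (\int[mu]_y F (x, y) =
    (pker 1 (b - x))%:E * \int[mu]_y (pker alpha (x - y) * `|v0 y| `^ p)%:E)%E.
  rewrite -ge0_integralZl//.
  - by apply: eq_integral => y _; rewrite /F/= -mulrA EFinM.
  - apply/measurable_EFinP; apply: measurable_funM => //.
    by apply: measurable_pkerB; exact: measurable_funB.
  - by move=> y _; rewrite lee_fin mulr_ge0 ?pker_ge0 ?powR_ge0.
  - by rewrite lee_fin pker_ge0.
have mRL : measurable_fun [set: R] (fun x => pker 1 (b - x) * `|RL alpha v0 x|).
  have := integrable_RL b alpha0 iv v0a => /integrableP[/measurable_EFinP m _].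
  rewrite (_ : (fun x => _) = (fun x => `|pker 1 (b - x) * RL alpha v0 x|)).
    exact: measurableT_comp.
  by apply/funext => x; rewrite normrM (ger0_norm (pker_ge0 _ _)).
apply: (@le_trans _ _ (\int[mu]_x ((A `^ (p - 1))%:E * \int[mu]_y F (x, y)))%E).
  apply: ge0_le_integral => //.
  - by move=> x _; rewrite lee_fin powR_ge0.
  - by apply/measurable_EFinP; exact: measurable_powR_comp.
  - by apply: measurable_funeM; exact: (measurable_fun_fubini_tonelli_F F mF).
  move=> x _; rewrite FE pker1 subr_gt0.
  have [xb|bx] := ltP x b.
    by rewrite mul1r mul1e; apply: RL_pointwise; exact: ltW.
  by rewrite mul0r mul0e mule0 powR0// gt_eqF.
rewrite ge0_integralZl//; last 3 first.
- exact: (measurable_fun_fubini_tonelli_F F mF).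
- by move=> x _; exact: integral_ge0.
- by rewrite lee_fin powR_ge0.
rewrite (fubini_tonelli F mF F0).
apply: (@le_trans _ _ ((A `^ (p - 1))%:E * \int[mu]_y (A%:E * (`|v0 y| `^ p)%:E))%E).
  apply: lee_wpmul2l; first by rewrite lee_fin powR_ge0.
  apply: ge0_le_integral => //.
  - by move=> y _; exact: integral_ge0.
  - exact: (measurable_fun_fubini_tonelli_G F mF).
  - by apply: measurable_funeM; exact/measurable_EFinP.
  move=> y _; rewrite /F/=; under eq_integral do rewrite EFinM.
  rewrite ge0_integralZr//; last 2 first.
  - apply/measurable_EFinP; apply: measurable_funM; apply: measurable_pkerB; exact: measurable_funB.
  - by move=> x _; rewrite lee_fin mulr_ge0 ?pker_ge0.
  have [ya|ay] := leP y a.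
    by rewrite v0a// normr0 powR0 ?gt_eqF// !mule0.
  by apply: lee_wpmul2r; rewrite ?lee_fin ?powR_ge0// A2// ltW.
rewrite ge0_integralZl//; last exact/measurable_EFinP.
rewrite muleA -EFinM; rewrite le_eqVlt; apply/orP; left; apply/eqP.
congr ((_)%:E * _)%E.
by rewrite mulrC mulr_powRB1.
Qed.

End riemann_liouville_Lp.
End young.

(** * The representation of u by its derivative, and the norm inequality *)

Section inequality.
Context {R : realType}.
Notation mu := (@lebesgue_measure R).
Implicit Types (a b c s r x y z t h alpha p : R) (f g u v w k : R -> R).

(* The value is 1 / Gamma alpha by the relation between Gamma and beta. *)
Definition repr_const alpha : R :=
  Gamma (1 - alpha) * fine (pbeta alpha 1) /
  (fine (pbeta alpha (1 - alpha)) * fine (pbeta 1 alpha)).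

Lemma fine_pbeta_gt0 s r : 0 < s -> 0 < r -> s <= 1 -> r <= 1 -> 0 < fine (pbeta s r).
Proof. by move=> s0 r0 s1 r1; rewrite fine_gt0// pbeta_gt0//= pbeta_lty. Qed.

Lemma repr_const_gt0 alpha : 0 < alpha -> alpha < 1 -> 0 < repr_const alpha.
Proof.
move=> alpha0 alpha1.
have alpha1' : 0 < 1 - alpha by rewrite subr_gt0.
have alpha0' : 1 - alpha <= 1 by rewrite gerBl ltW.
by rewrite divr_gt0 ?mulr_gt0 ?Gamma_gt0 ?fine_pbeta_gt0 ?(ltW alpha1).
Qed.

(** J^1 J^alpha v is a beta multiple of J^(alpha+1) v, hence [repr_const] is the factor for which
    both sides have the same primitive on []a, b[]; [ae0_of_primitive] then compares the functions
    themselves. *)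
Lemma weak_left_right_representation a b alpha u v w : a < b -> 0 < alpha -> alpha < 1 ->
  weak_frac_der_left a b alpha u v ->
  weak_frac_der_left (- b) (- a) alpha (fun x => u (- x)) (fun x => w (- x)) ->
  mu.-integrable [set: R] (EFin \o (v \_ `]a, b[)) ->
  mu.-integrable [set: R] (EFin \o (w \_ `]a, b[)) ->
  {ae mu, forall x, a < x < b ->
    u x = repr_const alpha * RL alpha (v \_ `]a, b[) x}.
Proof.
move=> ab alpha0 alpha1 uv uw iv iw.
have := weak_left_right_primitive ab alpha0 alpha1 uv uw iv iw.
case: uv => /Lp1_integrable iu _ _.
set u0 := (u \_ `]a, b[) in iu *.
set v0 := (v \_ `]a, b[) in iv *.
move=> prim.
have v0a y : y <= a -> v0 y = 0 by rewrite /v0 patch_itvE; case: ltP.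
have mp : measurable_fun [set: R] (fun x => pker 1 (b - x)).
  by apply: measurable_pkerB; exact: measurable_funB.
have pb x : `|pker 1 (b - x)| <= 1.
  by rewrite pker1; case: ltP => _ /=; rewrite ?normr1 ?normr0.
have iu' := integrable_bounded_mul mp pb iu.
have iv' := integrable_RL b alpha0 iv v0a.
set kappa := repr_const alpha.
(* The cut-off at [b] secures integrability: the tail of [RL alpha v0] may decay only like x^(alpha
   - 1). *)
pose h x := pker 1 (b - x) * u0 x - kappa * (pker 1 (b - x) * RL alpha v0 x).
have ikv : mu.-integrable [set: R] (EFin \o (fun x => kappa * (pker 1 (b - x) * RL alpha v0 x))).
  by apply: (@integrable_bounded_mul _ (fun=> kappa) _ `|kappa|).
have ih : mu.-integrable [set: R] (EFin \o h).
  exact: (@integrableB _ _ _ mu [set: R] measurableT _ _ iu' ikv).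
have h0 q : a < q < b -> \int[mu]_(x in `]-oo, q]) h x = 0.
  move=> /andP[aq qb].
  rewrite RintegralB//; [|exact: integrableS iu'|exact: integrableS ikv].
  rewrite RintegralZl//; last exact: integrableS iv'.
  rewrite -!RL1_closedE//.
  have E f : RL 1 (fun x => pker 1 (b - x) * f x) q = RL 1 f q.
    apply: eq_Rintegral => y _; rewrite mulrA; congr (_ * _).
    rewrite !pker1 !subr_gt0; case: ltP => yq; last by rewrite mul0r.
    by rewrite (lt_trans yq qb) mulr1.
  rewrite !E (RL_comp iv v0a) ?lerDl ?ltW// (addrC 1).
  have b0 : 0 < fine (pbeta alpha (1 - alpha)).
    by apply: fine_pbeta_gt0; rewrite ?subr_gt0 ?gerBl// ltW.
  have b1 : 0 < fine (pbeta 1 alpha) by apply: fine_pbeta_gt0; rewrite // ltW.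
  have alg (c0 c1 c2 c3 r1 r2 : R) : 0 < c0 -> 0 < c1 -> c0 * r1 = c2 * (c3 * r2) ->
      r1 - c2 * c3 / (c0 * c1) * (c1 * r2) = 0.
    move=> /lt0r_neq0 c00 /lt0r_neq0 c10 e; apply: (mulfI c00).
    by rewrite mulr0 mulrBr e; field; rewrite c00 c10.
  exact: alg b0 b1 (prim q (ltW qb)).
have := ae0_of_primitive ih h0.
have hE x : a < x < b -> h x = 0 -> u x = kappa * RL alpha v0 x.
  move=> /[dup] axb /andP[_ xb].
  rewrite /h pker1 subr_gt0 xb !mul1r => /eqP; rewrite subr_eq0 => /eqP <-.
  by rewrite /u0 patch_itvE axb.
by apply: (@filterS _ _ (ae_filter_ringOfSetsType mu)) => x + axb => /(_ axb); exact: hE.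
Qed.

Lemma Lp_normE (D : set R) p u :
  Lp_norm D p%:E u = ((\int[mu]_x (`|(u \_ D) x| `^ p)%:E) `^ p^-1)%E.
Proof. by rewrite /Lp_norm unlock. Qed.

Lemma Lp_norm_bound a b alpha p u v w : a < b -> 0 < alpha -> alpha < 1 -> 1 < p ->
  weak_frac_der_left a b alpha u v ->
  weak_frac_der_left (- b) (- a) alpha (fun x => u (- x)) (fun x => w (- x)) ->
  mu.-integrable [set: R] (EFin \o (v \_ `]a, b[)) ->
  mu.-integrable [set: R] (EFin \o (w \_ `]a, b[)) ->
  (Lp_norm `]a, b[ p%:E u <=
   (repr_const alpha * young_const alpha (b - a))%:E * Lp_norm `]a, b[ p%:E v)%E.
Proof.
move=> ab alpha0 alpha1 p1 uv uw iv iw.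
have rep := weak_left_right_representation ab alpha0 alpha1 uv uw iv iw.
case: uv => /Lp1_integrable iu _ _.
have p0 : 0 < p by apply: lt_trans p1.
have pN0 := lt0r_neq0 p0.
have v0a y : y <= a -> (v \_ `]a, b[) y = 0 by rewrite patch_itvE; case: ltP.
have Y := young ab alpha0 p1 iv v0a.
have k0 := repr_const_gt0 alpha0 alpha1.
have A0 : 0 <= young_const alpha (b - a).
  by rewrite mulr_ge0 ?powR_ge0// addr_ge0 ?fine_ge0 ?pbeta_ge0.
have kA0 : 0 <= repr_const alpha * young_const alpha (b - a) by rewrite mulr_ge0// ltW.
have mu0 : measurable_fun [set: R] (u \_ `]a, b[).
  by apply/measurable_EFinP; exact: measurable_int iu.
set u0 := (u \_ `]a, b[) in iu mu0 *.
set v0 := (v \_ `]a, b[) in iv v0a Y rep *.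
have mRL : measurable_fun [set: R] (fun x => pker 1 (b - x) * `|RL alpha v0 x|).
  have := integrable_RL b alpha0 iv v0a => /integrableP[/measurable_EFinP m _].
  rewrite (_ : (fun x => _) = (fun x => `|pker 1 (b - x) * RL alpha v0 x|)).
    exact: measurableT_comp.
  by apply/funext => x; rewrite normrM (ger0_norm (pker_ge0 _ _)).
have I : (\int[mu]_x (`|u0 x| `^ p)%:E <=
   ((repr_const alpha * young_const alpha (b - a)) `^ p)%:E * \int[mu]_y (`|v0 y| `^ p)%:E)%E.
  rewrite powRM ?(ltW k0)// EFinM -muleA.
  apply: le_trans (lee_wpmul2l _ Y); last by rewrite lee_fin powR_ge0.
  have mRLp : measurable_fun [set: R] (fun x => ((pker 1 (b - x) * `|RL alpha v0 x|) `^ p)%:E).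
    by apply/measurable_EFinP; exact: measurable_powR_comp.
  rewrite -ge0_integralZl//; last 2 first.
  - by move=> x _; rewrite lee_fin powR_ge0.
  - by rewrite lee_fin powR_ge0.
  apply: ae_ge0_le_integral => //.
  - by apply/measurable_EFinP; apply: measurable_powR_comp; exact: measurableT_comp.
  - by move=> x _; rewrite mule_ge0// lee_fin powR_ge0.
  - exact: measurable_funeM.
  have uE x : (a < x < b -> u x = repr_const alpha * RL alpha v0 x) ->
      `|u0 x| `^ p <= repr_const alpha `^ p * (pker 1 (b - x) * `|RL alpha v0 x|) `^ p.
    rewrite /u0 patch_itvE; case: ifPn => [axb /(_ isT) ->|_ _]; last first.
      by rewrite normr0 powR0// mulr_ge0 ?powR_ge0.
    case/andP: axb => _ xb; rewrite pker1 subr_gt0 xb mul1r.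
    by rewrite normrM (gtr0_norm k0) powRM// ltW.
  apply: (@filterS _ _ (ae_filter_ringOfSetsType mu)) rep => x /uE uEx _.
  by rewrite -EFinM lee_fin.
rewrite !Lp_normE.
have nn f : (0 <= \int[mu]_x (`|f x| `^ p)%:E)%E.
  by apply: integral_ge0 => x _; rewrite lee_fin powR_ge0.
apply: le_trans (gt0_ler_poweR _ _ _ I) _.
- by rewrite invr_ge0 ltW.
- by rewrite in_itv/= leey andbT nn.
- by rewrite in_itv/= leey andbT mule_ge0 ?nn// lee_fin powR_ge0.
rewrite poweRM ?nn ?lee_fin ?powR_ge0// poweR_EFin -powRrM mulfV// powRr1//.
Qed.

(** On the bounded interval |v| <= 1 + |v|^p. *)
Lemma Lp_integrable a b p v : 1 < p -> measurable_fun [set: R] (v \_ `]a, b[) ->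
  (Lp_norm `]a, b[ p%:E v < +oo)%E -> mu.-integrable [set: R] (EFin \o (v \_ `]a, b[)).
Proof.
move=> p1 mv N.
have p0 : 0 < p by apply: lt_trans p1.
have I : (\int[mu]_x (`|(v \_ `]a, b[) x| `^ p)%:E < +oo)%E.
  have := poweR_Lnorm mu (EFin \o (v \_ `]a, b[)) (lt0r_neq0 p0) => /= <-.
  exact: poweR_lty.
have mp : measurable_fun [set: R] (fun x => `|(v \_ `]a, b[) x| `^ p).
  by apply: measurable_powR_comp; exact: measurableT_comp.
have ip : mu.-integrable [set: R] (fun x => (`|(v \_ `]a, b[) x| `^ p)%:E).
  apply/integrableP; split; first exact/measurable_EFinP.
  by under eq_integral do rewrite /= ger0_norm ?powR_ge0//.
have i1 : mu.-integrable [set: R] (fun x => (\1_(`]a, b[%classic : set R) x)%:E).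
  exact: integrable_indic_itv.
apply: le_integrable (integrableD _ i1 ip) => //; first exact/measurable_EFinP.
have vE x : `|(v \_ `]a, b[) x| <= \1_(`]a, b[%classic : set R) x + `|(v \_ `]a, b[) x| `^ p.
  rewrite patchE indicE; case: ifP => _; last by rewrite normr0 addr_ge0// powR_ge0.
  have [v1|v1] := leP `|v x| 1; first by rewrite (le_trans v1)// lerDl powR_ge0.
  rewrite -[leLHS]add0r lerD// -[leLHS]powRr1//.
  by rewrite ler_powR// ltW.
move=> x _; rewrite /= lee_fin; apply: le_trans (vE x) _.
exact: ler_norm.
Qed.

Lemma Lp_norm_opp a b p u : measurable_fun [set: R] (u \_ `]a, b[) ->
  Lp_norm `](- b), (- a)[ p%:E (fun x => u (- x)) = Lp_norm `]a, b[ p%:E u.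
Proof.
move=> mu0; have mp : measurable_fun [set: R] (fun x => (`|(u \_ `]a, b[) x| `^ p)%:E).
  by apply/measurable_EFinP; apply: measurable_powR_comp; exact: measurableT_comp.
have := integralN_arg mp.
rewrite !Lp_normE.
rewrite patch_oppE.
by move=> ->.
Qed.

End inequality.

Theorem theorem5p12 (R : realType) (a b alpha : R)
    (hab : a < b) (halpha0 : 0 < alpha) (halpha1 : alpha < 1) :
  exists C : R, 0 < C /\
    forall p : R, 1 < p ->
    forall u : R -> R, Sobolev a b alpha p%:E u ->
      (forall v : R -> R, weak_frac_der_left a b alpha u v ->
        (Lp_norm `]a, b[ p%:E u <= C%:E * Lp_norm `]a, b[ p%:E v)%E) /\
      (forall v : R -> R, weak_frac_der_right a b alpha u v ->
        (Lp_norm `]a, b[ p%:E u <= C%:E * Lp_norm `]a, b[ p%:E v)%E).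
Proof.
have C0 : 0 < repr_const alpha * young_const alpha (b - a).
  apply: mulr_gt0; first exact: repr_const_gt0.
  by rewrite mulr_gt0 ?powR_gt0 ?subr_gt0// addr_gt0// fine_pbeta_gt0// ltW.
(* Mathematically this is 2 (b - a)^alpha / Gamma (alpha + 1). *)
exists (repr_const alpha * young_const alpha (b - a)); split => // p p1 u [].
have Lp_int w : locally_integrable `]a, b[ w -> Lp `]a, b[ p%:E w ->
    (@lebesgue_measure R).-integrable [set: R] (EFin \o (w \_ `]a, b[)).
  move=> lw; rewrite /Lp/= inE => /andP[_]; rewrite inE => N.
  by apply: (Lp_integrable p1) => //; exact: locally_integrable_patch.
move=> [_ [vl [Lvl ul]]] [_ [vr [Lvr ur]]].
have ivl : (@lebesgue_measure R).-integrable [set: R] (EFin \o (vl \_ `]a, b[)).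
  by apply: Lp_int => //; case: ul.
have ivr : (@lebesgue_measure R).-integrable [set: R] (EFin \o (vr \_ `]a, b[)).
  by apply: Lp_int => //; case: ur.
split=> v uv.
- have mv : measurable_fun [set: R] (v \_ `]a, b[).
    by apply: locally_integrable_patch; case: uv.
  (* [v] is any weak derivative and is not identified with [vl]: an infinite norm makes the bound
     trivial, and a finite one gives the integrability that is used. *)
  have [N|] := ltP (Lp_norm `]a, b[ p%:E v) +oo%E; last first.
    by rewrite leye_eq => /eqP ->; rewrite gt0_muley ?lte_fin// leey.
  apply: (Lp_norm_bound hab halpha0 halpha1 p1 uv (weak_right_opp hab halpha0 halpha1 ur)) => //.
  exact: (Lp_integrable p1).
- have mv : measurable_fun [set: R] (v \_ `]a, b[).
    by apply: locally_integrable_patch; case: uv.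
  have mu0 : measurable_fun [set: R] (u \_ `]a, b[).
    by case: uv => /Lp1_integrable/measurable_int/measurable_EFinP.
  have [N|] := ltP (Lp_norm `]a, b[ p%:E v) +oo%E; last first.
    by rewrite leye_eq => /eqP ->; rewrite gt0_muley ?lte_fin// leey.
  have iv := Lp_integrable p1 mv N.
  rewrite -(Lp_norm_opp p mu0) -(Lp_norm_opp p mv).
  rewrite (_ : b - a = - a - - b); last by rewrite opprK addrC.
  (* Reflection exchanges the roles: [v] now provides the left derivative, and [vl], recovered by
     reflecting twice, the companion on the other side. *)
  apply: (@Lp_norm_bound _ (- b) (- a) alpha p _ _ (fun x => vl (- x))) => //.
  + by rewrite ltrN2.
  + exact: weak_right_opp.
  + rewrite !opprK.
    by under eq_fun do rewrite opprK; under [X in weak_frac_der_left _ _ _ _ X]eq_fun do rewrite opprK.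
  + by rewrite patch_oppE; exact: integrableN_arg.
  + by rewrite patch_oppE; exact: integrableN_arg.
Qed.
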